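(* Let $f:\mathbb{R}^n\times\mathbb{R}^m\to\mathbb{R}^n$ be continuous with $\sup_{y\in\mathbb{R}^m}|f(x,y)|\le a+b|x|$ for all $x\in\mathbb{R}^n$, for some $a,b>0$. Let $g:\mathbb{R}^n\times\mathbb{R}^m\times\mathbb{R}\to\mathbb{R}^m$ be admissible (for every compact $K\subset\mathbb{R}^n\times\mathbb{R}^m$, $g$ is bounded and uniformly continuous on $K\times\mathbb{R}$) and uniformly Lipschitz in $y$ on compact sets (for all compact $K_0\subset\mathbb{R}^n$, $K\subset\mathbb{R}^m$ there is $L=L(K_0,K)$ with $|g(x,y_1,\tau)-g(x,y_2,\tau)|\le L|y_1-y_2|$ for all $y_1,y_2\in K$, $x\in K_0$, $\tau\in\mathbb{R}$). Let $\mathcal{H}$ be the hull of $g$ and $\mathcal{O}(g)\subset\mathcal{H}$ its omega-limit set. Assume that for each $h\in\{g\cdot\tau_0\mid\tau_0\ge0\}\cup\mathcal{O}(g)$, $x\in\mathbb{R}^n$, $y_0\in\mathbb{R}^m$ the solution $y(\tau,h,x,y_0)$ is defined for all $\tau\ge0$, and that for each compact $K_0\subset\mathbb{R}^n$ the solutions of the parametric family $y'=g(x,y,\tau)$, $x\in K_0$, are uniformly ultimately bounded on $[0,\infty)$. Fix $x_0\in\mathbb{R}^n$, $y_0\in\mathbb{R}^m$, $t_0>0$, and let $\varepsilon_k\downarrow0$ be such that the problems $$\dot x=f(x,y),\qquad \varepsilon\dot y=g(x,y,t/\varepsilon),\qquad x(0)=x_0,\ y(0)=y_0$$ with $\varepsilon=\varepsilon_k$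 have solutions $(x_{\varepsilon_k}(t),y_{\varepsilon_k}(t))$ on $[0,t_0]$ with $x_{\varepsilon_k}(t)$ converging to $x_0(t)$ uniformly on $[0,t_0]$. Write $Y_{\varepsilon_k}(\tau):=y_{\varepsilon_k}(\varepsilon_k\tau)$, $\tau\in[0,t_0/\varepsilon_k]$. For a fixed small $r>0$ let $K_0:=\{x_0(t)+x\mid t\in[0,t_0],\ x\in\mathbb{R}^n,\ |x|\le r\}$ and let $\mathbb{A}\subset\mathcal{O}(g)\times K_0\times\mathbb{R}^m$ be the global attractor of the skew-product semiflow $\pi$ on $\mathcal{O}(g)\times K_0\times\mathbb{R}^m$, with sections $A_{(h,x)}$. For each integer $k\ge1$ let $$\delta_k:=\inf\big\{\delta>0\mid \mathrm{dist}\big(g\cdot(t_0/\varepsilon_k),\mathcal{O}(g)\big)\le\delta\ \text{ and }\ \mathrm{dist}\big(Y_{\varepsilon_k}(t_0/\varepsilon_k),B_{(g\cdot(t_0/\varepsilon_k),\,x_0(t_0))}[\delta]\big)\le\delta\big\}.$$ Then: (i) $\lim_{k\to\infty}\delta_k=0$; (ii) $\lim_{k\to\infty}\mathrm{dist}\big(Y_{\varepsilon_k}(t_0/\varepsilon_k),B_{(g\cdot(t_0/\varepsilon_k),\,x_0(t_0))}[\delta_k]\big)=0$; (iii) if $g\cdot(t_0/\varepsilon_k)\to h_0$ in $(\mathcal{H},d)$ as $k\to\infty$, then $h_0\in\mathcal{O}(g)$ and $\lim_{k\to\infty}\mathrm{dist}\big(Y_{\varepsilon_k}(t_0/\vareps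ilon_k),A_{(h_0,\,x_0(t_0))}\big)=0$.
   Context: Hull. $(g\cdot s)(x,y,\tau)=g(x,y,\tau+s)$; the hull $\mathcal{H}$ is the closure of $\{g\cdot s\mid s\in\mathbb{R}\}$ in the compact-open topology, a compact metric space with a fixed metric $d$, on which $(\tau,h)\mapsto h\cdot\tau$ (translation in the last variable) is a continuous flow. $\mathcal{O}(g)\subset\mathcal{H}$ is the omega-limit set of $g$, i.e. the set of limits of sequences $g\cdot\tau_k$ with $\tau_k\to\infty$; it is compact and invariant. Solutions. For $h\in\mathcal{H}$, $x\in\mathbb{R}^n$: $y(\tau,h,x,\tau_0,y_0)$ is the solution of $y'=h(x,y,\tau)$ ($x$ a fixed parameter) with $y(\tau_0)=y_0$, and $y(\tau,h,x,y_0):=y(\tau,h,x,0,y_0)$. Uniform ultimate boundedness on $[0,\infty)$ of $y'=g(x,y,\tau)$, $x\in K_0$: there is $c>0$ such that for every $\rho>0$ there is $T=T(\rho)$ with $|y(\tau+\tau_0,g,x,\tau_0,y_0)|\le c$ for all $x\in K_0$, $\tau_0\ge0$, $\tau\ge T$, $|y_0|\le \rho$. Semiflow: $\pi(\tau,h,x,y_0)=(h\cdot\tau,x,y(\tau,h,x,y_0))$, $\tau\ge0$, on $\mathcal{O}(g)\times K_0\times\mathbb{R}^m$. Under the stated assumptions it has a global attractor $\mathbb{A}$, i.e. the nonempty compact set with $\pi_\tau(\mathbb{A})=\mathbb{A}$ for all $\tau\ge0$ and $\lim_{\tau\to\infty}\mathrm{dist}(\pi_\tau(\mathcal{O}(g)\times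 K_0\times D),\mathbb{A})=0$ for every bounded $D\subset\mathbb{R}^m$. Sections: $A_{(h,x)}=\{y\mid(h,x,y)\in\mathbb{A}\}$ for $(h,x)\in\mathcal{O}(g)\times K_0$. For $h\in\mathcal{H}$, $x\in K_0$ and $\delta\ge\mathrm{dist}(h,\mathcal{O}(g))$, $$B_{(h,x)}[\delta]:=\bigcup\big\{A_{(\tilde h,\tilde x)}\mid(\tilde h,\tilde x)\in\mathcal{O}(g)\times K_0,\ d(\tilde h,h)\le\delta,\ |\tilde x-x|\le\delta\big\}.$$ $\mathrm{dist}(Y_1,Y_2)=\sup_{y_1\in Y_1}\inf_{y_2\in Y_2}d(y_1,y_2)$ is the Hausdorff semidistance (distance from a point to a set when $Y_1$ is a point). *)

(* Defs.v *)
From HB Require Import structures.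
From mathcomp Require Import all_boot all_order all_algebra.
From mathcomp Require Import all_classical all_reals all_analysis.
Set Implicit Arguments.
Unset Strict Implicit.
Unset Printing Implicit Defensive.
Import Order.TTheory GRing.Theory Num.Theory.
Import numFieldNormedType.Exports.
Local Open Scope classical_set_scope.
Local Open Scope ring_scope.

(* The norm `|u| provided by the library on row vectors is the max norm, so
   the Euclidean norm is defined here.  Topological notions (compactness,
   continuity, ...) use the library's topology, which is the usual one. *)
Definition eucl_norm {R : realType} {k : nat} (u : 'rV[R]_k) : R :=
  Num.sqrt (\sum_(i < k) u ord0 i ^+ 2).

Definition eucl_dist {R : realType} {k : nat} (u v : 'rV[R]_k) : R := eucl_norm (u - v).

(* Extended-real valued, so that an infinite supremum is not collapsed to 0 and
   the distance from a nonempty set to the empty set is +oo. *)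
Definition hsdist {R : realType} {T : Type} (d : T -> T -> R) (Y1 Y2 : set T) :
    \bar R :=
  ereal_sup [set ereal_inf [set (d y1 y2)%:E | y2 in Y2] | y1 in Y1].

Definition metric_on {R : realType} {T : Type} (X : set T) (d : T -> T -> R) :=
  [/\ forall p q, X p -> X q -> 0 <= d p q,
      forall p q, X p -> X q -> (d p q = 0 <-> p = q),
      forall p q, X p -> X q -> d p q = d q p
    & forall p q s, X p -> X q -> X s -> d p s <= d p q + d q s].

(* d induces on X the subspace topology. *)
Definition metrizes {R : realType} {T : topologicalType} (X : set T)
    (d : T -> T -> R) :=
  forall p, X p -> forall U : set T,
    within X (nbhs p) U <->
    exists2 e : R, 0 < e & forall q, X q -> d p q < e -> U q.

Section FastSlow.
Context {R : realType} {n m : nat}.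

(* Right-hand sides h(x, y, tau), with the compact-open topology. *)
Definition rhs := {compact-open, ('rV[R]_n * 'rV[R]_m * R)%type -> 'rV[R]_m}.

Implicit Types (g h : rhs) (x : 'rV[R]_n).

Definition admissible g :=
  forall K : set ('rV[R]_n * 'rV[R]_m), compact K ->
    [bounded g p | p in K `*` [set: R]] /\
    unif_continuous (g : subspace (K `*` [set: R]) -> 'rV[R]_m).

Definition unif_lipschitz g :=
  forall (K0 : set 'rV[R]_n) (K : set 'rV[R]_m), compact K0 -> compact K ->
    exists L : R, forall x y1 y2 (tau : R), K0 x -> K y1 -> K y2 ->
      eucl_norm (g (x, y1, tau) - g (x, y2, tau)) <= L * eucl_norm (y1 - y2).

Definition translate g (s : R) : rhs := fun p => g (p.1, p.2 + s).

(* The closure is taken in the space of continuous functions: the compact-open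
   topology of the library lives on all functions. *)
Definition hull g : set rhs :=
  [set h : rhs | continuous (h : 'rV[R]_n * 'rV[R]_m * R -> 'rV[R]_m) /\
                 closure (range (translate g) : set rhs) h].

Definition omega_limit g : set rhs :=
  [set h : rhs | hull g h /\ exists tau : nat -> R,
     tau k @[k --> \oo] --> +oo /\
     (fun k => translate g (tau k)) @ \oo --> h].

(* At an endpoint of I contained in I only continuity is required; as h is
   continuous, the one-sided derivative then exists there and satisfies the
   equation. *)
Definition solves h x (I : set R) (y : R -> 'rV[R]_m) :=
  {within I, continuous y} /\
  forall t : R, interior I t -> derivable y t 1 /\ 'D_1 y t = h (x, y t, t).

Definition forward_solution h x (tau0 : R) (y0 : 'rV[R]_m) (y : R -> 'rV[R]_m) :=
  y tau0 = y0 /\ solves h x `[tau0, +oo[ y.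

Definition forward_defined h x (y0 : 'rV[R]_m) := exists y, forward_solution h x 0 y0 y.

(* sol h x tau0 y0 tau is y(tau, h, x, tau0, y0); it is meaningful for
   tau0 <= tau when a solution on [tau0, +oo[ exists. *)
Definition sol h x (tau0 : R) (y0 : 'rV[R]_m) : R -> 'rV[R]_m :=
  xget (fun=> y0) [set y | forward_solution h x tau0 y0 y].

Definition unif_ultimately_bounded g (K0 : set 'rV[R]_n) :=
  exists2 c : R, 0 < c & forall rho : R, 0 < rho ->
    exists2 T : R, 0 <= T &
      forall x (tau0 tau : R) (y0 : 'rV[R]_m), K0 x -> 0 <= tau0 -> T <= tau ->
        eucl_norm y0 <= rho -> eucl_norm (sol g x tau0 y0 (tau + tau0)) <= c.

Definition semiflow (tau : R) (p : rhs * 'rV[R]_n * 'rV[R]_m) :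
    rhs * 'rV[R]_n * 'rV[R]_m :=
  (translate p.1.1 tau, p.1.2, sol p.1.1 p.1.2 0 p.2 tau).

Definition prod_dist (d : rhs -> rhs -> R) (p q : rhs * 'rV[R]_n * 'rV[R]_m) :
    R :=
  Num.max (d p.1.1 q.1.1) (Num.max (eucl_dist p.1.2 q.1.2) (eucl_dist p.2 q.2)).

(* D is taken nonempty because hsdist of the empty set is -oo; attraction of
   the empty set is void. *)
Definition global_attractor (d : rhs -> rhs -> R) g (K0 : set 'rV[R]_n)
    (A : set (rhs * 'rV[R]_n * 'rV[R]_m)) :=
  [/\ A `<=` omega_limit g `*` K0 `*` [set: 'rV[R]_m],
      A !=set0,
      compact A,
      forall tau : R, 0 <= tau -> semiflow tau @` A = A
    & forall D : set 'rV[R]_m, bounded_set D -> D !=set0 ->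
        hsdist (prod_dist d) (semiflow tau @` (omega_limit g `*` K0 `*` D)) A
          @[tau --> +oo] --> 0%E].

Definition attractor_section (A : set (rhs * 'rV[R]_n * 'rV[R]_m)) h x : set 'rV[R]_m :=
  [set y | A (h, x, y)].

(* The union B_(h,x)[delta]; the radius is extended-real because it is applied
   to an infimum. *)
Definition inflated_section (d : rhs -> rhs -> R) g (K0 : set 'rV[R]_n)
    (A : set (rhs * 'rV[R]_n * 'rV[R]_m)) h x (delta : \bar R) :
    set 'rV[R]_m :=
  \bigcup_(p in [set p : rhs * 'rV[R]_n |
      [/\ omega_limit g p.1, K0 p.2,
          ((d p.1 h)%:E <= delta)%E & ((eucl_norm (p.2 - x))%:E <= delta)%E]])
    attractor_section A p.1 p.2.

Definition tube (t0 r : R) (xlim : R -> 'rV[R]_n) : set 'rV[R]_n :=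
  [set xlim t + x | t in `[0, t0] & x in [set x | eucl_norm x <= r]].

Definition fast_slow_solution (f : 'rV[R]_n * 'rV[R]_m -> 'rV[R]_n) g
    (x0 : 'rV[R]_n) (y0 : 'rV[R]_m) (t0 eps : R)
    (x : R -> 'rV[R]_n) (y : R -> 'rV[R]_m) :=
  [/\ {within `[0, t0], continuous x}, {within `[0, t0], continuous y},
      x 0 = x0, y 0 = y0
    & forall t, 0 < t < t0 ->
        [/\ derivable x t 1, derivable y t 1, 'D_1 x t = f (x t, y t)
          & eps *: 'D_1 y t = g (x t, y t, t / eps)]].

Definition fast_time (eps : R) (y : R -> 'rV[R]_m) (tau : R) := y (eps * tau).

(* delta_k for h = g . (t0 / eps_k), x = x_0(t0), Y = Y_(eps_k)(t0 / eps_k);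
   the infimum of the empty set is +oo. *)
Definition delta_inf (d : rhs -> rhs -> R) g (K0 : set 'rV[R]_n)
    (A : set (rhs * 'rV[R]_n * 'rV[R]_m)) h x (Y : 'rV[R]_m) : \bar R :=
  ereal_inf [set delta%:E | delta in [set delta : R |
    [/\ 0 < delta,
        (hsdist d [set h] (omega_limit g) <= delta%:E)%E
      & (hsdist eucl_dist [set Y] (inflated_section d g K0 A h x delta%:E)
           <= delta%:E)%E]]].

End FastSlow.
Arguments rhs : clear implicits.

(* Main.v *)
(* Write T_k = t_0 / eps_k.  Limits are taken along an ultrafilter F on the
   indices finer than the cofinite filter, which replaces all extractions of
   subsequences.  Admissibility makes the translates of g equicontinuous and
   pointwise bounded, so they converge along F in the compact-open topology.  On
   a window of fixed length in the fast time the slow variable becomes constant,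
   so by Gronwall's lemma Y_k follows a solution of a limiting frozen equation;
   with ultimate boundedness this bounds Y_k on all of [0, T_k].  Applied to the
   windows [T_k - s, T_k], it shows that the limit (h_0, x_0(t_0), y) of
   (g . T_k, x_0(t_0), Y_k(T_k)) lies, for every s > 0, in
   pi_s (O(g) x K_0 x D) with D a fixed ball.  Hence it is at distance 0 from the
   attractor, which is compact and so contains it; the three assertions follow
   from this and the compactness of the attractor. *)
Require Import Defs.
From HB Require Import structures.
From mathcomp Require Import all_boot all_order all_algebra.
From mathcomp Require Import all_classical all_reals all_analysis.
From mathcomp Require Import ring lra.
Set Implicit Arguments.
Unset Strict Implicit.
Unset Printing Implicit Defensive.
Import Order.TTheory GRing.Theory Num.Theory.
Import numFieldNormedType.Exports.
Local Open Scope classical_set_scope.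
Local Open Scope ring_scope.

(** * Norms and Gronwall's lemma *)

Section norms.
Context {R : realType} {k : nat}.
Implicit Types u v : 'rV[R]_k.

Lemma coord_le_norm u i : `|u ord0 i| <= `|u|.
Proof. by rewrite [leRHS]/Num.norm/= mx_normrE; apply: (le_bigmax _ _ (ord0, i)). Qed.

Lemma norm_le_coord u (c : R) : 0 <= c -> (forall i, `|u ord0 i| <= c) -> `|u| <= c.
Proof.
move=> c0 uc; rewrite [leLHS]/Num.norm/= mx_normrE; apply: bigmax_le => //= -[i j] _ /=.
by rewrite (ord1 i).
Qed.

Lemma norm_le_eucl u : `|u| <= eucl_norm u.
Proof.
apply: norm_le_coord => [|i]; first exact: sqrtr_ge0.
rewrite -sqrtr_sqr ler_wsqrtr// (bigD1 i)//= lerDl.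
by apply: sumr_ge0 => j _; exact: sqr_ge0.
Qed.

Lemma sum_sqr_le_norm u : \sum_(i < k) u ord0 i ^+ 2 <= k%:R * `|u| ^+ 2.
Proof.
have -> : k%:R * `|u| ^+ 2 = \sum_(i < k) `|u| ^+ 2.
  by rewrite sumr_const card_ord mulr_natl.
apply: ler_sum => i _.
by rewrite -(real_normK (num_real _)) lerXn2r ?nnegrE ?coord_le_norm.
Qed.

(** The constant [k.+1] is cruder than the square root of [k], but it is positive for every [k], so
    later estimates can divide by it. *)
Lemma eucl_le_norm u : eucl_norm u <= k.+1%:R * `|u|.
Proof.
rewrite -[leRHS]ger0_norm ?mulr_ge0// -sqrtr_sqr ler_wsqrtr//.
apply: (le_trans (sum_sqr_le_norm u)).
rewrite exprMn ler_wpM2r ?sqr_ge0// -natrX ler_nat.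
by rewrite (leq_trans (leqnSn k))// leq_pmulr.
Qed.

Lemma eucl_norm_ge0 u : 0 <= eucl_norm u.
Proof. exact: sqrtr_ge0. Qed.

Lemma eucl_normB u v : eucl_norm (u - v) = eucl_norm (v - u).
Proof.
by congr Num.sqrt; apply: eq_bigr => i _; rewrite !mxE -sqrrN opprB.
Qed.

Lemma eucl_norm0 : eucl_norm (0 : 'rV[R]_k) = 0.
Proof. by rewrite /eucl_norm big1 ?sqrtr0// => i _; rewrite mxE expr0n. Qed.

Lemma continuous_sum_sqr : continuous (fun u => \sum_(i < k) u ord0 i ^+ 2).
Proof.
apply: continuous_big => [|i _ u]; first exact: add_continuous.
apply: (@continuous_comp _ _ _ (fun u : 'rV[R]_k => u ord0 i) (fun x : R => x ^+ 2)).
  exact: coord_continuous.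
exact: exprn_continuous.
Qed.

Lemma continuous_eucl_norm : continuous (@eucl_norm R k).
Proof.
move=> u; apply: (@continuous_comp _ _ _ (fun u : 'rV[R]_k => \sum_(i < k) u ord0 i ^+ 2)).
  exact: continuous_sum_sqr.
exact: sqrt_continuous.
Qed.

Lemma compact_norm_le (M : R) : compact [set u : 'rV[R]_k | `|u| <= M].
Proof.
apply: bounded_closed_compact.
  exists M; split; first exact: num_real.
  by move=> M' MM' u /= uM; rewrite (le_trans uM)// ltW.
rewrite (_ : mkset _ = Num.norm @^-1` [set x | x <= M])//.
apply: closed_comp; last exact: closed_le.
by move=> x _; exact: norm_continuous.
Qed.

End norms.

Section gronwall.
Context {R : realType}.

(* The differential inequality is only available while [phi <= 1], but at the first
   time where [phi] reaches 1 it already forces [phi < 1]. *)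
Lemma gronwall_confined (phi : R -> R) (S a b : R) :
  0 <= a -> 0 <= b -> (forall s, 0 <= phi s) ->
  {within `[0, S], continuous phi} ->
  (forall s, 0 < s < S -> derivable phi s 1) ->
  (forall s, 0 < s < S -> phi s <= 1 -> 'D_1 phi s <= a * (phi s + b)) ->
  (phi 0 + b) * expR (a * S) < 1 ->
  forall s, 0 <= s <= S -> phi s <= (phi 0 + b) * expR (a * S).
Proof.
move=> a0 b0 phi0 cphi dphi Dphi small.
(* As long as [phi <= 1], the integrating factor makes [psi] nonincreasing, since its derivative is
   [expR (- a * u)] times [phi' - a * (phi + b)]. *)
have bound s : 0 <= s <= S -> (forall u, 0 <= u < s -> phi u <= 1) ->
    phi s <= (phi 0 + b) * expR (a * S).
  move=> /andP[s0 sS] confined.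
  pose psi u := (phi u + b) * expR (- a * u).
  have der u : 0 < u < S -> is_derive u 1 psi
      ('D_1 phi u * expR (- a * u) + (phi u + b) * (- a * expR (- a * u))).
    move=> /dphi/derivableP dphiu.
    rewrite /psi; apply: is_derive_eq.
    by rewrite /GRing.scale/= addr0; ring.
  have sub u : 0 < u < s -> 0 < u < S by move=> /andP[-> /lt_le_trans]; apply.
  have : psi s <= psi 0.
    apply: (@ler0_derive1_le_cc _ psi 0 s) => //; rewrite ?in_itv/= ?lexx ?s0//.
    - by move=> u /[!in_itv]/= /sub/der[].
    - move=> u /[!in_itv]/= us; rewrite derive1E.
      have [_ ->] := der _ (sub _ us).
      have /Dphi : 0 < u < S by exact: sub.
      case/andP: us => u0 us /(_ (confined _ _)).
      rewrite (ltW u0) us => /(_ isT).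
      have := expR_gt0 (- a * u); set E := expR _ => E0 H.
      have := ler_wpM2r (ltW E0) H; lra.
    - apply: (@continuous_subspaceW _ _ _ `[0, S]).
        by move=> u /=; rewrite !in_itv/= => /andP[-> /le_trans->].
      move=> u; apply: (@continuousM _ (subspace `[0, S])
         (fun u => phi u + b) (fun u => expR (- a * u))).
        apply: (@continuousD _ _ (subspace `[0, S])); first exact: cphi.
        by move=> ?; exact: cst_continuous.
      apply: continuous_subspaceT => {}u.
      apply: (@continuous_comp _ _ _ ( *%R (- a)) expR); last exact: continuous_expR.
      exact: mulrl_continuous.
  rewrite /psi mulr0 expR0 mulr1 mulNr expRN ler_pdivrMr ?expR_gt0// => H.
  apply: (@le_trans _ _ (phi s + b)); first by rewrite lerDl.
  apply: (le_trans H); rewrite ler_wpM2l ?addr_ge0//.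
  by rewrite ler_expR ler_wpM2l.
move=> s /andP[s0 sS]; apply: (bound s); first by rewrite s0.
move=> u /andP[u0 us]; rewrite leNgt; apply/negP => pu.
have cphiu : {within `[0, u], continuous phi}.
  apply: continuous_subspaceW cphi => v /=; rewrite !in_itv/= => /andP[-> vu].
  by rewrite (le_trans vu)// (le_trans (ltW us)).
(* The least point [v] of this compact set is the first time at which [phi] reaches 1. [bound]
   applies up to [v] and contradicts [1 <= phi v]. *)
pose K := [set v | 1 <= phi v] `&` `[0, u].
have cK : compact K.
  apply: (@subclosed_compact _ _ `[0, u]) => //; last by move=> v [].
    rewrite closed_setIS; last exact: interval_closed.
    apply: (@closed_comp (subspace `[0, u]) R phi [set x | 1 <= x]).
      by move=> v _; exact: cphiu.
    exact: closed_ge.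
  exact: segment_compact.
have K0 : K !=set0 by exists u; split; [exact: ltW | rewrite /= in_itv/= u0 lexx].
have [v /set_mem[/= pv vu] vmin] : exists2 v, v \in K & forall t, t \in K -> v <= t.
  apply: (@compact_EVT_min _ _ id) => //.
  by apply: continuous_subspaceT => ?; exact: cvg_id.
move: vu; rewrite in_itv/= => /andP[v0 vu].
have : phi v <= (phi 0 + b) * expR (a * S).
  apply: bound => [|t /andP[t0 tv]].
    by rewrite v0 (le_trans vu)// (le_trans (ltW us)).
  rewrite leNgt; apply/negP => pt; have := tv; rewrite ltNge => /negP; apply.
  apply: vmin; apply/mem_set; split; first exact: ltW.
  by rewrite /= in_itv/= t0 (le_trans (ltW tv)).
by rewrite leNgt (lt_le_trans small).
Qed.

End gronwall.

Section vector_gronwall.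
Context {R : realType} {m : nat}.
Implicit Types (y z G H : R -> 'rV[R]_m).

Definition ode_on (S : R) G y :=
  {within `[0, S], continuous y} /\
  forall s, 0 < s < S -> derivable y s 1 /\ 'D_1 y s = G s.

(** The max norm is not differentiable, so Gronwall is applied to the sum of squares [phi] of the
    coordinates of [y - z]. With [w] the norm of [y - z], each coordinate contributes at most
    [2 * w * (L * w + eta)] to its derivative, and [2 * w * eta <= w ^+ 2 + eta ^+ 2] bounds this by
    [(2 * L + 1) * (phi + eta ^+ 2)]. The estimate on [G - H] is asked only at distance at most 1,
    because Lipschitz constants are available only on compact sets. *)
Lemma vector_gronwall (S L eta : R) G H y z :
  0 <= L -> 0 <= eta -> ode_on S G y -> ode_on S H z ->
  (forall s, 0 < s < S -> `|y s - z s| <= 1 ->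
     `|G s - H s| <= L * `|y s - z s| + eta) ->
  let bound := (m%:R * `|y 0 - z 0| ^+ 2 + eta ^+ 2) *
    expR (m%:R * (2 * L + 1) * S) in
  bound < 1 -> forall s, 0 <= s <= S -> `|y s - z s| ^+ 2 <= bound.
Proof.
move=> L0 eta0 [cy dy] [cz dz] GH bound small s sS.
pose phi s := \sum_(i < m) (y s - z s) ord0 i ^+ 2.
have norm_phi u : `|y u - z u| ^+ 2 <= phi u.
  rewrite -(@sqr_sqrtr _ (phi u)); last by apply: sumr_ge0 => i _; exact: sqr_ge0.
  by rewrite lerXn2r ?nnegrE ?sqrtr_ge0//; exact: norm_le_eucl.
have phi0 : phi 0 + eta ^+ 2 <= m%:R * `|y 0 - z 0| ^+ 2 + eta ^+ 2.
  by rewrite lerD2r; exact: sum_sqr_le_norm.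
have a0 : 0 <= m%:R * (2 * L + 1) :> R by rewrite mulr_ge0// addr_ge0// mulr_ge0.
have phib : (phi 0 + eta ^+ 2) * expR (m%:R * (2 * L + 1) * S) <= bound.
  by rewrite ler_wpM2r ?expR_ge0.
apply: (le_trans (norm_phi s)); apply: (le_trans _ phib).
have der u : 0 < u < S -> is_derive u 1 phi
    (\sum_(i < m) 2 * (y u - z u) ord0 i * (G u - H u) ord0 i).
  move=> uS.
  have [dyu <-] := dy _ uS.
  have [dzu <-] := dz _ uS.
  rewrite [phi](_ : _ = \sum_(i < m) ((fun s => y s ord0 i) - (fun s => z s ord0 i)) ^+ 2); last first.
    by apply/funext => v; rewrite fct_sumE; apply: eq_bigr => i _; rewrite !mxE.
  apply: is_derive_sum => i.
  have dyi : is_derive u 1 (fun s => y s ord0 i) ('D_1 y u ord0 i).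
    rewrite (derive_mx dyu) mxE; apply/derivableP.
    exact: (iffLR (derivable_mxP y u 1) dyu ord0 i).
  have dzi : is_derive u 1 (fun s => z s ord0 i) ('D_1 z u ord0 i).
    rewrite (derive_mx dzu) mxE; apply/derivableP.
    exact: (iffLR (derivable_mxP z u 1) dzu ord0 i).
  by apply: is_derive_eq; rewrite !mxE/= /GRing.scale/= expr1.
apply: gronwall_confined => //.
- exact: sqr_ge0.
- by move=> u; apply: sumr_ge0 => i _; exact: sqr_ge0.
- move=> u; apply: (@continuous_comp (subspace `[0, S]) _ _ (fun u => y u - z u)
    (fun v : 'rV[R]_m => \sum_(i < m) v ord0 i ^+ 2)); last exact: continuous_sum_sqr.
  by apply: (@continuousB _ _ (subspace `[0, S])); [exact: cy|exact: cz].
- by move=> u /der[].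
- move=> u uS phiu; have [_ ->] := der _ uS.
  have w1 : `|y u - z u| <= 1.
    by rewrite -(@ler_pXn2r _ 2)// ?nnegrE// expr1n (le_trans (norm_phi u)).
  have := GH u uS w1; have := norm_phi u.
  set w := `|_|; set g := `|_| => wphi gw.
  have w0 : 0 <= w by exact: normr_ge0.
  apply: (@le_trans _ _ (\sum_(i < m) 2 * w * g)).
    apply: ler_sum => i _; apply: (le_trans (ler_norm _)).
    rewrite !normrM (@ger0_norm _ 2)// ler_pM// ?mulr_ge0//.
      by rewrite ler_wpM2l// coord_le_norm.
    exact: coord_le_norm.
  rewrite sumr_const card_ord -[leLHS]mulr_natl -(mulrA m%:R) ler_wpM2l//.
  rewrite -mulrA.
  have : 2 * (w * g) <= 2 * (w * (L * w + eta)) by rewrite ler_wpM2l// ler_wpM2l.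
  move/le_trans; apply.
  have : L * w ^+ 2 <= L * phi u by rewrite ler_wpM2l.
  have : 0 <= (w - eta) ^+ 2 by exact: sqr_ge0.
  have : 0 <= L * eta ^+ 2 by rewrite mulr_ge0// sqr_ge0.
  rewrite !expr2; lra.
- exact: le_lt_trans phib small.
Qed.

End vector_gronwall.

(** * Convergence of translates along an ultrafilter *)

Section ultrafilters.

Lemma ultra_fmap {I T : Type} (F : set_system I) (u : I -> T) :
  UltraFilter F -> UltraFilter (u @ F).
Proof.
move=> FU; split; first exact: fmap_proper_filter.
move=> G GF sFG; apply/seteqP; split=> // A GA.
have [//|FA] := in_ultra_setVsetC (u @^-1` A) FU.
have /filter_ex[x []//] : G (A `&` ~` A) by apply: filterI => //; exact: sFG.
Qed.

Lemma ultra_compact_cvg {I : Type} {T : topologicalType} (F : set_system I)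
    (u : I -> T) (K : set T) :
  UltraFilter F -> compact K -> (\forall i \near F, K (u i)) ->
  exists2 l, K l & u @ F --> l.
Proof.
move=> FU + FK; rewrite compact_ultra => /(_ (u @ F) (ultra_fmap _ FU) FK).
by move=> [l [Kl ul]]; exists l.
Qed.

(** If [P] failed infinitely often, the cofinite filter restricted to its complement would be proper
    and would extend to an ultrafilter containing that complement. This brings facts proved along
    ultrafilters back to limits along [\oo]. *)
Lemma near_ultra (P : set nat) :
  (forall F : set_system nat, UltraFilter F -> \oo `<=` F -> F P) -> \forall k \near \oo, P k.
Proof.
move=> H; apply: contrapT => nP.
have within_proper : ProperFilter (within (~` P) \oo).
  split; last exact: within_filter.
  move=> H0; apply: nP; move: H0; apply: (@filterS _ \oo) => k /= nnP.
  exact: contrapT.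
have [F [FU withinF]] := ultraFilterLemma within_proper.
have FP : F P by apply: H => U ooU; apply: withinF; exact: (@cvg_within _ \oo).
have FnP : F (~` P) by apply: withinF; exact: withinT.
by have [k []] := @filter_ex _ F _ _ (filterI FP FnP).
Qed.

End ultrafilters.

Section rhs.
Context {R : realType} {n m : nat}.

(** The times are unrestricted, so one modulus [del] serves all time translates and passes to their
    pointwise limits. *)
Definition unif_on_balls (h : 'rV[R]_n * 'rV[R]_m * R -> 'rV[R]_m) :=
  forall M e : R, 0 < e -> exists2 del : R, 0 < del &
    forall x x' y y' t t', `|x| <= M -> `|x'| <= M -> `|y| <= M -> `|y'| <= M ->
      `|x - x'| < del -> `|y - y'| < del -> `|t - t'| < del ->
      `|h (x, y, t) - h (x', y', t')| < e.

Lemma unif_on_balls_equicontinuous h : unif_on_balls h ->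
  equicontinuous [set: R] (fun s p => h (p.1, p.2 + s)).
Proof.
move=> hu [[x y] t] E; rewrite -entourage_ballE => -[e /= e0 eE].
(* The extra 1 keeps the unit ball around [(x, y)] inside the ball of radius [M], where the modulus
   is valid. *)
pose M := Num.max `|x| `|y| + 1.
have [del del0 H] := hu M e e0.
have xM : `|x| <= M - 1 by rewrite addrK le_max lexx.
have yM : `|y| <= M - 1 by rewrite addrK le_max lexx orbT.
have del1 : 0 < Num.min del 1 by rewrite lt_min del0/=.
have := nbhsx_ballx (x, y, t) _ del1; apply: filterS => -[[x' y'] t'] [[]] /=.
rewrite -!ball_normE/= !lt_min.
move=> /andP[xx xx1] /andP[yy yy1] /andP[tt _] s _; apply: eE => /=; rewrite -ball_normE/=.
have bd (V : normedModType R) (a b : V) : `|a| <= M - 1 -> `|a - b| < 1 -> `|b| <= M.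
  move=> aM ab; rewrite -[b](subKr a); apply: (le_trans (ler_normB _ _)).
  by rewrite -[M](subrK 1) lerD// ltW.
by apply: H => //; [lra|exact: bd xx1|lra|exact: bd yy1|rewrite opprD addrACA subrr addr0].
Qed.

Lemma unif_on_balls_continuous h : unif_on_balls h -> continuous h.
Proof.
move=> /unif_on_balls_equicontinuous/(equicontinuous_continuous (i := 0)) => /(_ I).
suff -> : (fun p => h (p.1, p.2 + 0)) = h by [].
by apply/funext => -[p t] /=; rewrite addr0.
Qed.

Context (g : rhs R n m).
Hypothesis g_adm : admissible g.

Lemma compact_ballX (M : R) :
  compact ([set x : 'rV[R]_n | `|x| <= M] `*` [set y : 'rV[R]_m | `|y| <= M]).
Proof. by apply: compact_setX; exact: compact_norm_le. Qed.

Lemma admissible_bounded (M : R) : exists B : R,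
  forall x y t, `|x| <= M -> `|y| <= M -> `|g (x, y, t)| <= B.
Proof.
have [[B [_ bB]] _] := g_adm (@compact_ballX M).
by exists (B + 1) => x y t xM yM; apply: (bB (B + 1) _ (x, y, t)) => //; rewrite ltrDl.
Qed.

Lemma admissible_unif : unif_on_balls g.
Proof.
move=> M e e0; have [_ gu] := g_adm (@compact_ballX M).
have := gu [set xy | ball xy.1 e xy.2].
rewrite /= -entourage_ballE => /(_ _)[|E]; first by exists e.
rewrite -entourage_ballE => -[del /= del0 delE] EA; exists del => // x x' y y' t t'.
move=> xM x'M yM y'M xx yy tt.
have := EA ((x, y, t), (x', y', t')); rewrite /= -ball_normE; apply.
by right; split => //; split => //; apply: delE; split => //=; first split; rewrite -ball_normE.
Qed.

Lemma admissible_continuous : continuous g.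
Proof. exact: unif_on_balls_continuous admissible_unif. Qed.

Lemma continuous_translate s : continuous (translate g s).
Proof.
have := unif_on_balls_equicontinuous admissible_unif.
by move=> /(equicontinuous_continuous (i := s)) /(_ I).
Qed.

Lemma hull_translate s : hull g (translate g s).
Proof. by split; [exact: continuous_translate|apply: subset_closure; exists s]. Qed.

(** Towards a continuous limit, convergence in the compact-open topology is uniform convergence on
    compact sets. *)
Lemma cvg_translate_unif {I : Type} (F : set_system I) (tau : I -> R) (h : rhs R n m)
    (K : set ('rV[R]_n * 'rV[R]_m * R)) (e : R) :
  Filter F -> continuous h -> (fun i => translate g (tau i)) @ F --> h ->
  compact K -> 0 < e ->
  \forall i \near F, forall p, K p -> `|h p - g (p.1, p.2 + tau i)| < e.
Proof.
move=> FF ch + cK e0; move/(@compact_open_fam_compactP _ _ h _ ch)/fam_cvgP => /(_ K cK).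
move=> /(_ [set f | forall p, K p -> `|h p - f p| < e]); apply.
apply/uniform_nbhs; exists [set xy | ball xy.1 e xy.2]; split.
  by rewrite -entourage_ballE; exists e.
by move=> f H p /H; rewrite -ball_normE.
Qed.

Lemma cvg_translate_pointwise {I : Type} (F : set_system I) (tau : I -> R)
    (h : rhs R n m) p :
  Filter F -> continuous h -> (fun i => translate g (tau i)) @ F --> h ->
  g (p.1, p.2 + tau i) @[i --> F] --> h p.
Proof.
move=> FF ch gh; apply/cvgrPdist_lt => e e0.
have := cvg_translate_unif FF ch gh (@compact_set1 _ p) e0.
by apply: filterS => i; exact.
Qed.

(** This is the Arzela-Ascoli theorem along an ultrafilter: boundedness gives pointwise limits, the
    limit inherits the modulus of [g], and equicontinuity upgrades pointwise to compact-open
    convergence. *)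
Lemma ultra_cvg_translate {I : Type} (F : set_system I) (tau : I -> R) :
  UltraFilter F -> exists2 h, hull g h & (fun i => translate g (tau i)) @ F --> h.
Proof.
move=> FU.
have pw p : exists l : 'rV[R]_m, g (p.1, p.2 + tau i) @[i --> F] --> l.
  case: p => [[x y] t].
  have [B gB] := admissible_bounded (Num.max `|x| `|y|).
  have [|l _ gl] := ultra_compact_cvg (u := fun i => g ((x, y), t + tau i)) FU
     (@compact_norm_le R m B); last by exists l.
  by apply: nearW => i /=; apply: gB; rewrite le_max lexx ?orbT.
have [h gh] := choice pw.
have hu : unif_on_balls h.
  move=> M e e0; have e4 : 0 < e / 4 by rewrite divr_gt0.
  (* Two approximations of [h] by a common translate and one use of the modulus cost three times
     [e / 4]. *)
  have [del del0 H] := admissible_unif M e4.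
  exists del => // x x' y y' t t' xM x'M yM y'M xx yy tt.
  have /cvgrPdist_lt/(_ _ e4) h1 := gh (x, y, t).
  have /cvgrPdist_lt/(_ _ e4) h2 := gh (x', y', t').
  have [i [/= {}h1 {}h2]] := @filter_ex _ F _ _ (filterI h1 h2).
  have ttau : `|t + tau i - (t' + tau i)| < del by rewrite opprD addrACA subrr addr0.
  have {ttau} := H _ _ _ _ _ _ xM x'M yM y'M xx yy ttau.
  move: h1 h2; set a := h _; set b := h _; set c := g _; set c' := g _ => h1 h2 h3.
  rewrite -(subrKA c) -(subrKA c' c) (le_lt_trans (ler_normD _ _))//.
  rewrite (distrC b) in h2.
  by have := ler_normD (c - c') (c' - b); lra.
have ch := unif_on_balls_continuous hu.
have cvg_h : (fun i => translate g (tau i)) @ F --> (h : rhs R n m).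
  apply/(@compact_open_fam_compactP _ _ h _ ch).
  have eqc : \forall W \near powerset_filter_from ((fun i => translate g (tau i)) @ F),
      equicontinuous W id.
    rewrite near_powerset_filter_fromP; last exact: equicontinuous_subset_id.
    exists (range (translate g)); first by apply: nearW => i; exists (tau i).
    move=> p E entE; have := unif_on_balls_equicontinuous admissible_unif p entE.
    by apply: filterS => q H _ [s _ <-]; exact: H.
  apply: (iffLR (pointwise_compact_cvg _ _ eqc)).
  by apply/pointwise_cvgP => p; exact: gh.
exists h => //; split=> // U hU.
have [i Ui] := @filter_ex _ F _ _ (cvg_h _ hU).
by exists (translate g (tau i)); split=> //; exists (tau i).
Qed.

(** An ultrafilter decides each condition [B < tau i]. If one of them fails, [tau] stays in the
    compact interval [0, B] and converges there. *)
Lemma ultra_cvg_real {I : Type} (F : set_system I) (tau : I -> R) :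
  UltraFilter F -> (forall i, 0 <= tau i) ->
  tau @ F --> +oo \/ exists2 l : R, 0 <= l & tau @ F --> l.
Proof.
move=> FU tau0; have [?|/cvgryPgt] := pselect (tau @ F --> +oo); first by left.
move=> /existsNP[B FB]; right.
have [//|FBC] := in_ultra_setVsetC [set i | B < tau i] FU.
have [|l /= + taul] := @ultra_compact_cvg _ R F tau `[0, B] FU (@segment_compact _ 0 B).
  by apply: filterS FBC => i /= /negP; rewrite in_itv/= -leNgt tau0.
by rewrite in_itv/= => /andP[l0 _]; exists l.
Qed.

Lemma cvg_translate_translate {I : Type} (F : set_system I) (tau : I -> R) (s : R)
    (h : rhs R n m) :
  ProperFilter F -> continuous h -> (fun i => translate g (tau i)) @ F --> h ->
  tau @ F --> s -> h = translate g s.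
Proof.
move=> FF ch gh taus; apply/funext => p.
have h1 := cvg_translate_pointwise (p := p) _ ch gh.
have h2 : g (p.1, p.2 + tau i) @[i --> F] --> translate g s p.
  have h3 : p.2 + tau i @[i --> F] --> p.2 + s by apply: cvgD => //; exact: cvg_cst.
  have h4 : p.1 @[_ --> F] --> p.1 by exact: cvg_cst.
  exact: (cvg_comp _ g (cvg_pair h4 h3) (@admissible_continuous (p.1, p.2 + s))).
exact: (cvg_unique (@norm_hausdorff _ _) (h1 _) h2).
Qed.

Variable d : rhs R n m -> rhs R n m -> R.
Hypothesis d_metric : metric_on (hull g) d.
Hypothesis d_metrizes : metrizes (hull g) d.

Lemma metrizes_cvgP {I : Type} (F : set_system I) (u : I -> rhs R n m) h :
  Filter F -> hull g h -> (forall i, hull g (u i)) ->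
  u @ F --> h <-> forall e, 0 < e -> \forall i \near F, d h (u i) < e.
Proof.
move=> FF hh hu; split=> [uh e e0|uh U hU].
  have : within (hull g) (nbhs h) [set q | d h q < e].
    by apply/d_metrizes => //; exists e.
  by move=> /uh; apply: (@filterS _ F) => i /(_ (hu i)).
have [|e e0 He] := (d_metrizes hh U).1; first by apply: (@filterS _ (nbhs h) _ U).
by apply: (filterS _ (uh e e0)) => i; apply: He; exact: hu.
Qed.

(** [omega_limit] asks for a sequence, whereas [F] is an arbitrary proper filter. The metric allows
    a choice, for each [k], of an index with time above [k] and distance below [1 / (k + 1)]. *)
Lemma omega_limit_cvg {I : Type} (F : set_system I) (tau : I -> R) h :
  ProperFilter F -> hull g h -> (fun i => translate g (tau i)) @ F --> h ->
  tau @ F --> +oo -> omega_limit g h.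
Proof.
move=> FF hh gh tauy; split=> //.
have hu i : hull g (translate g (tau i)) by exact: hull_translate.
have ex k : exists i, k%:R < tau i /\ d h (translate g (tau i)) < k.+1%:R^-1.
  have /cvgryPgt/(_ k%:R) F1 := tauy.
  have F2 := (metrizes_cvgP FF hh hu).1 gh k.+1%:R^-1.
  by apply: (@filter_ex _ F); apply: filterI => //; apply: F2; rewrite invr_gt0.
have [i_ Hi] := choice ex.
exists (tau \o i_); split.
  apply/cvgryPge => B; near=> k.
  apply: le_trans (ltW (Hi k).1); near: k; exact: nbhs_infty_ger.
apply/(metrizes_cvgP (u := fun k => translate g (tau (i_ k)))) => // e e0.
near=> k; apply: (lt_trans (Hi k).2).
by near: k; exact: (near_infty_natSinv_lt (PosNum e0)).
Unshelve. all: by end_near. Qed.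

Lemma hull_dist0 p q : hull g p -> hull g q -> d p q = 0 -> p = q.
Proof. by move=> hp hq; have [_ H _ _] := d_metric; apply H. Qed.

End rhs.

(** * Continuous dependence on parameters *)

Section dependence.
Context {R : realType} {n m : nat} (g : rhs R n m).
Hypothesis g_adm : admissible g.
Hypothesis g_lip : unif_lipschitz g.

Lemma lipschitz_max_norm (M : R) : exists2 L : R, 0 <= L &
  forall x y1 y2 t, `|x| <= M -> `|y1| <= M -> `|y2| <= M ->
    `|g (x, y1, t) - g (x, y2, t)| <= L * `|y1 - y2|.
Proof.
have [L HL] := g_lip (@compact_norm_le R n M) (@compact_norm_le R m M).
(* The Lipschitz constant may be negative, hence its absolute value; the factor [m.+1] converts the
   Euclidean norm to the max norm. *)
exists (`|L| * m.+1%:R); first by rewrite mulr_ge0.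
move=> x y1 y2 t xM y1M y2M.
apply: (le_trans (norm_le_eucl _)); apply: (le_trans (HL x y1 y2 t xM y1M y2M)).
rewrite -mulrA; apply: (@le_trans _ _ (`|L| * eucl_norm (y1 - y2))).
  by rewrite ler_wpM2r ?eucl_norm_ge0// ler_norm.
by rewrite ler_wpM2l// eucl_le_norm.
Qed.

Lemma ode_on_le (S T : R) (G y : R -> 'rV[R]_m) : T <= S -> ode_on S G y -> ode_on T G y.
Proof.
move=> TS [cy dy]; split.
  apply: continuous_subspaceW cy => s /=; rewrite !in_itv/= => /andP[-> sT].
  exact: le_trans TS.
by move=> s /andP[s0 sT]; apply: dy; rewrite s0 (lt_le_trans sT).
Qed.

Lemma norm_bounded_itv (S : R) (y : R -> 'rV[R]_m) : {within `[0, S], continuous y} ->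
  exists B, forall s, 0 <= s <= S -> `|y s| <= B.
Proof.
move=> cy; have [S0|S0] := leP 0 S; last first.
  by exists 0 => s /andP[s0 sS]; have := le_trans s0 sS; rewrite leNgt S0.
have [|c _ cmax] := @EVT_max _ (fun s => `|y s|) 0 S S0.
  move=> s; apply: (@continuous_comp (subspace `[0, S]) _ _ y Num.norm); first exact: cy.
  exact: norm_continuous.
by exists `|y c| => s sS; apply: cmax; rewrite in_itv.
Qed.

(** The equation of [Y i] is a perturbation of the one frozen at [x] with right-hand side [h], and
    Gronwall compares their solutions. The lengths [Si i] may vary below [S], which allows windows
    cut off at the end of the interval of definition. *)
Lemma continuous_dependence {I : Type} (F : set_system I) (tau Si : I -> R)
    (h : rhs R n m) (x : 'rV[R]_n) (S : R) (X : I -> R -> 'rV[R]_n)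
    (Y : I -> R -> 'rV[R]_m) (y : R -> 'rV[R]_m) :
  Filter F -> continuous h -> (fun i => translate g (tau i)) @ F --> h ->
  (\forall i \near F, Si i <= S) ->
  (\forall i \near F, ode_on (Si i) (fun s => g (X i s, Y i s, s + tau i)) (Y i)) ->
  (forall e, 0 < e -> \forall i \near F, forall s, 0 <= s <= Si i -> `|X i s - x| < e) ->
  Y i 0 @[i --> F] --> y 0 ->
  ode_on S (fun s => h (x, y s, s)) y ->
  forall e, 0 < e -> \forall i \near F, forall s, 0 <= s <= Si i -> `|Y i s - y s| <= e.
Proof.
move=> FF ch gh SiS odeY Xx Y0 odey e e0.
have [B yB] := norm_bounded_itv odey.1.
(* The margin of 1 keeps [X i] in the ball of radius [M] when it is 1-close to [x], and [Y i] when
   it is 1-close to [y]. *)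
pose M := Num.max `|x| B + 1.
have xM : `|x| <= M - 1 by rewrite addrK le_max lexx.
have yM s : 0 <= s <= S -> `|y s| <= M - 1.
  by move=> /yB ysB; rewrite addrK le_max ysB orbT.
have [L L0 gL] := lipschitz_max_norm M.
pose E := expR (m%:R * (2 * L + 1) * S).
have E0 : 0 < E := expR_gt0 _.
(* The Gronwall bound must be below both [e ^+ 2] and 1. Its two terms, initial error and
   [eta ^+ 2], are each made at most [c], and [(c + c) * E = k]. *)
pose k := Num.min (e ^+ 2) (2^-1).
have k0 : 0 < k by rewrite lt_min exprn_gt0//= invr_gt0.
pose c := k / (2 * E).
have c0 : 0 < c by rewrite divr_gt0// mulr_gt0.
pose eta := Num.min 1 c.
have eta0 : 0 < eta by rewrite lt_min c0 andbT.
have eta2 : eta ^+ 2 <= c.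
  apply: (@le_trans _ _ eta); last by rewrite ge_min lexx orbT.
  by rewrite expr2 -[leRHS]mul1r ler_wpM2r ?(ltW eta0)// ge_min lexx.
have [del del0 gdel] := admissible_unif g_adm M (divr_gt0 eta0 (ltr0n R 2)).
have K_compact : compact ([set x] `*` [set y : 'rV[R]_m | `|y| <= M] `*` `[0, S]).
  apply: compact_setX; last exact: segment_compact.
  by apply: compact_setX; [exact: compact_set1|exact: compact_norm_le].
have gK := cvg_translate_unif FF ch gh K_compact (divr_gt0 eta0 (ltr0n R 2)).
have Xdel := Xx (Num.min 1 del); rewrite lt_min del0 ltr01 in Xdel.
have w0 : 0 < Num.min 1 (c / m.+1%:R) by rewrite lt_min ltr01 divr_gt0.
move/cvgrPdist_lt : Y0 => /(_ _ w0) Y0.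
have {}Xdel := Xdel isT.
near=> i.
have SiSi : Si i <= S by near: i.
have odeYi : ode_on (Si i) (fun s => g (X i s, Y i s, s + tau i)) (Y i) by near: i.
have Y0i : `|y 0 - Y i 0| < Num.min 1 (c / m.+1%:R) by near: i.
have Xdeli : forall s, 0 <= s <= Si i -> `|X i s - x| < Num.min 1 del by near: i.
have gKi : forall p, ([set x] `*` [set y | `|y| <= M] `*` `[0, S]) p ->
  `|h p - g (p.1, p.2 + tau i)| < eta / 2 by near: i.
move=> s sSi.
have bnd : (m%:R * `|Y i 0 - y 0| ^+ 2 + eta ^+ 2) *
    expR (m%:R * (2 * L + 1) * Si i) <= k.
  move: Y0i; rewrite distrC lt_min => /andP[Y01 Y0c].
  have Y0ge := normr_ge0 (Y i 0 - y 0).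
  have : m%:R * `|Y i 0 - y 0| ^+ 2 <= c.
    apply: (@le_trans _ _ (m.+1%:R * `|Y i 0 - y 0|)).
      rewrite ler_pM// ?sqr_ge0//; first by rewrite ler_nat.
      by rewrite expr2 -[leRHS]mul1r ler_wpM2r// ltW.
    by rewrite mulrC -ler_pdivlMr ?ltr0Sn// ltW.
  move=> Yc; apply: (@le_trans _ _ ((c + c) * E)).
    apply: ler_pM; [|exact: expR_ge0|exact: lerD|].
      by apply: addr_ge0; [apply: mulr_ge0|]; rewrite ?sqr_ge0 ?ler0n.
    by rewrite /E ler_expR ler_wpM2l// mulr_ge0// addr_ge0// mulr_ge0.
  by rewrite (_ : (c + c) * E = k)// /c; field; rewrite gt_eqF.
have := @vector_gronwall R m (Si i) L eta _ _ (Y i) y L0 (ltW eta0) odeYi (ode_on_le SiSi odey).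
move=> /(_ _ _ s sSi) H.
rewrite -(@ler_pXn2r _ 2)// ?nnegrE// ?(ltW e0)//.
apply: (le_trans (H _ _)).
- move=> u /andP[u0 uSi] Yy1.
  have uS : 0 <= u <= S by rewrite ltW//= (le_trans (ltW uSi)).
  have uSi' : 0 <= u <= Si i by rewrite !ltW.
  have := Xdeli u uSi'; rewrite lt_min => /andP[X1 Xd].
  have XM : `|X i u| <= M.
    by rewrite -(subrK x (X i u)) (le_trans (ler_normD _ _))//; lra.
  have yuM := yM u uS.
  have YM : `|Y i u| <= M.
    by rewrite -(subrK (y u) (Y i u)) (le_trans (ler_normD _ _))//; lra.
  have g1 := gL _ _ _ (u + tau i) XM YM (_ : `|y u| <= M).
  have {}g1 : `|g (X i u, Y i u, u + tau i) - g (X i u, y u, u + tau i)| <=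
      L * `|Y i u - y u| by apply: g1; lra.
  have g2 : `|g (X i u, y u, u + tau i) - g (x, y u, u + tau i)| < eta / 2.
    by apply: gdel; rewrite ?subrr ?normr0//; lra.
  have g3 : `|h (x, y u, u) - g (x, y u, u + tau i)| < eta / 2.
    by apply: (gKi (x, y u, u)); split=> /=; [split=> //=; lra|rewrite in_itv].
  rewrite distrC in g3.
  (* The right-hand sides differ by a Lipschitz term in the fast variable, by [eta / 2] for freezing
     the slow variable, and by [eta / 2] for replacing the translate of [g] by [h]. *)
  rewrite -(subrKA (g (X i u, y u, u + tau i))) (le_trans (ler_normD _ _))//.
  rewrite lerD// -(subrKA (g (x, y u, u + tau i))) (le_trans (ler_normD _ _))//.
  by rewrite [leRHS](splitr eta) lerD// ltW.
- by apply: (le_lt_trans bnd); rewrite gt_min; apply/orP; right; lra.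
by apply: (le_trans bnd); rewrite ge_min lexx.
Unshelve. all: by end_near. Qed.

End dependence.

(** * Affine changes of time and forward solutions *)

Section reparametrization.
Context {R : realType} {m : nat}.

Lemma within_continuous_affine (a b : R) (D J : set R) (y : R -> 'rV[R]_m) :
  {within J, continuous y} -> (forall s, D s -> J (a * (s + b))) ->
  {within D, continuous (fun s => y (a * (s + b)))}.
Proof.
move=> /subspace_continuousP cy DJ; apply/subspace_continuousP => s Ds U /= Uy.
have cphi : {for s, continuous (fun s : R => a * (s + b))}.
  by apply: cvgM; [exact: cvg_cst|apply: cvgD; [exact: cvg_id|exact: cvg_cst]].
have := cy _ (DJ s Ds) U Uy; rewrite /= /within /= => /cphi.
by apply: (@filterS _ (nbhs s)) => u /= H Du; apply/H/DJ.
Qed.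

Lemma derive_affine (a b s : R) (y : R -> 'rV[R]_m) : derivable y (a * (s + b)) 1 ->
  derivable (fun s => y (a * (s + b))) s 1 /\
  'D_1 (fun s => y (a * (s + b))) s = a *: 'D_1 y (a * (s + b)).
Proof.
move=> dys.
have dphi : is_derive s (1 : R) (fun s : R => a * (s + b)) a.
  by apply: is_derive_eq; rewrite /GRing.scale/= addr0 mulr1.
have der i j : is_derive s (1 : R) (fun s => y (a * (s + b)) i j)
    (('D_1 y (a * (s + b))) i j * a).
  apply: (@is_derive1_comp _ (fun t => y t i j) (fun s => a * (s + b))).
  rewrite (derive_mx dys) mxE; apply/derivableP.
  exact: (iffLR (derivable_mxP y _ 1) dys i j).
have dery : derivable (fun s => y (a * (s + b))) s 1.
  by apply/derivable_mxP => k l; have [] := der k l.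
split=> //; rewrite (derive_mx dery); apply/matrixP => k l; rewrite !mxE.
by have [_ ->] := der k l; rewrite mulrC.
Qed.

(** Used with [a = 1] to shift the time origin and with [a = eps k] to pass to the fast time. *)
Lemma ode_on_affine (a b S : R) (J : set R) (y G : R -> 'rV[R]_m) :
  {within J, continuous y} ->
  (forall s, 0 <= s <= S -> J (a * (s + b))) ->
  (forall s, 0 < s < S -> derivable y (a * (s + b)) 1 /\
     a *: 'D_1 y (a * (s + b)) = G s) ->
  ode_on S G (fun s => y (a * (s + b))).
Proof.
move=> cy SJ dy; split; first by apply: within_continuous_affine cy _ => s /SJ.
by move=> s /dy[dys <-]; exact: derive_affine.
Qed.

End reparametrization.

Section solutions.
Context {R : realType} {n m : nat}.
Implicit Types (h : rhs R n m) (y : 'rV[R]_m).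

Lemma sol_solution h x (t0 : R) y : (exists z, forward_solution h x t0 y z) ->
  forward_solution h x t0 y (sol h x t0 y).
Proof. exact: xgetPex. Qed.

Lemma forward_solution_ode_on h x (t0 : R) y z S : forward_solution h x t0 y z ->
  ode_on S (fun s => h (x, z (s + t0), s + t0)) (fun s => z (s + t0)).
Proof.
move=> [_ [cz dz]].
have -> : (fun s => z (s + t0)) = (fun s => z (1 * (s + t0))).
  by apply/funext => s; rewrite mul1r.
apply: (ode_on_affine cz) => s /andP[s0 _].
  by rewrite /= in_itv/= mul1r andbT lerDr.
rewrite !mul1r scale1r; apply: dz.
by rewrite interior_itv_bndy /= in_itv/= andbT ltrDr.
Qed.

(** Global existence is assumed from time 0 only; shifting time carries it over to the initial time
    [t0]. *)
Lemma forward_solution_translate h x (t0 : R) y : forward_defined (translate h t0) x y ->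
  exists z, forward_solution h x t0 y z.
Proof.
move=> [z [z0 [cz dz]]]; exists (fun s => z (1 * (s - t0))); split.
  by rewrite subrr mulr0.
split.
  apply: (within_continuous_affine cz) => s.
  by rewrite /= !in_itv/= !andbT mul1r subr_ge0.
move=> s; rewrite interior_itv_bndy /= in_itv/= andbT => ts.
have := dz (1 * (s - t0)); rewrite interior_itv_bndy /= in_itv/= andbT mul1r subr_gt0.
move=> /(_ ts)[dzs Dzs].
have [|ds ->] := @derive_affine R m 1 (- t0) s z; first by rewrite mul1r.
by split=> //; rewrite scale1r mul1r Dzs /translate/= subrK.
Qed.

End solutions.

(** * The fast variable near the end of the slow time interval *)

Section fast_slow_limit.
Context {R : realType} {n m : nat} (f : 'rV[R]_n * 'rV[R]_m -> 'rV[R]_n) (g : rhs R n m).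
Context (d : rhs R n m -> rhs R n m -> R).
Context (x0 : 'rV[R]_n) (y0 : 'rV[R]_m) (t0 : R).
Context (eps : nat -> R) (xk : nat -> R -> 'rV[R]_n) (yk : nat -> R -> 'rV[R]_m).
Context (xlim : R -> 'rV[R]_n).
Hypothesis g_adm : admissible g.
Hypothesis g_lip : unif_lipschitz g.
Hypothesis d_metric : metric_on (hull g) d.
Hypothesis d_metrizes : metrizes (hull g) d.
Hypothesis g_forward : forall h,
  ([set translate g tau0 | tau0 in [set s | 0 <= s]] `|` omega_limit g) h ->
  forall x y, forward_defined h x y.
Hypothesis g_bounded : forall K : set 'rV[R]_n, compact K -> unif_ultimately_bounded g K.
Hypothesis t0_gt0 : 0 < t0.
Hypothesis eps_gt0 : forall k, 0 < eps k.
Hypothesis eps_cvg0 : eps @ \oo --> 0.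
Hypothesis xyk_solution : forall k, fast_slow_solution f g x0 y0 t0 (eps k) (xk k) (yk k).
Hypothesis xk_cvg : {uniform `[0, t0], xk @ \oo --> xlim}.

Let T k := t0 / eps k.

Lemma xlim_continuous : {within `[0, t0], continuous xlim}.
Proof.
apply: (@uniform_limit_continuous_subspace _ _ _ (xk @ \oo)) => //.
suff : \forall k \near \oo, {within `[0, t0], continuous (xk k)} by [].
by apply: nearW => k; have [] := xyk_solution k.
Qed.

Lemma xk_cvg_near e : 0 < e ->
  \forall k \near \oo, forall t, 0 <= t <= t0 -> `|xk k t - xlim t| < e.
Proof.
move=> e0; apply: (xk_cvg (t := [set h | forall t, 0 <= t <= t0 -> `|h t - xlim t| < e])).
apply/uniform_nbhs; exists [set xy | ball xy.1 e xy.2]; split.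
  by rewrite -entourage_ballE; exists e.
move=> h H t tt0; have := H t; rewrite /= in_itv/= => /(_ tt0).
by rewrite -ball_normE/= distrC.
Qed.

Lemma T_cvgy : T @ \oo --> +oo.
Proof.
apply/cvgryPge => B; move/cvgrPdist_lt : eps_cvg0 => H.
pose B' := Num.max B 1.
have B0 : 0 < B' by rewrite lt_max ltr01 orbT.
have {}H := H (t0 / B') (divr_gt0 t0_gt0 B0).
near=> k.
have : `|0 - eps k| < t0 / B' by near: k.
rewrite sub0r normrN gtr0_norm// ltr_pdivlMr// mulrC -ltr_pdivlMr// => BT.
by rewrite (le_trans _ (ltW BT))// le_max lexx.
Unshelve. all: by end_near. Qed.

(** A window of fast length at most [S] has slow length at most [eps (k i) * S], which tends to 0.
    Uniform convergence of [xk] and continuity of [xlim] at [ts] then each cost [e / 2]. *)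
Lemma slow_cvg {I : Type} (F : set_system I) (k : I -> nat) (sigma Si : I -> R) (S ts : R) :
  Filter F -> k @ F --> \oo -> 0 <= ts <= t0 ->
  (\forall i \near F, 0 <= sigma i) ->
  (\forall i \near F, Si i <= S /\ Si i + sigma i <= T (k i)) ->
  eps (k i) * sigma i @[i --> F] --> ts ->
  forall e, 0 < e -> \forall i \near F, forall s, 0 <= s <= Si i ->
    `|xk (k i) (eps (k i) * (s + sigma i)) - xlim ts| < e.
Proof.
move=> FF kF tst0 sigma0 SiS sigmats e e0.
have e2 : 0 < e / 2 by rewrite divr_gt0.
have := iffLR (@subspace_continuousP _ `[0, t0] _ xlim) xlim_continuous ts.
rewrite /= in_itv/= => /(_ tst0)/cvgrPdist_lt/(_ _ e2).
rewrite /within/= -filter_from_ballE => -[del /= del0 Hdel].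
have xkF : \forall i \near F, forall t, 0 <= t <= t0 -> `|xk (k i) t - xlim t| < e / 2.
  exact: (kF _ (xk_cvg_near e2)).
(* [S] may be 0 or negative, so a positive majorant is used as divisor. *)
have S1 : 0 < `|S| + 1 by rewrite ltr_wpDl.
have epsF : \forall i \near F, eps (k i) < del / 2 / (`|S| + 1).
  have e3 : 0 < del / 2 / (`|S| + 1) by rewrite !divr_gt0.
  move/cvgrPdist_lt : eps_cvg0 => /(_ _ e3) /kF; apply: (@filterS _ F) => j /=.
  by rewrite sub0r normrN gtr0_norm.
have sigF : \forall i \near F, `|ts - eps (k i) * sigma i| < del / 2.
  by move/cvgrPdist_lt : sigmats; apply; rewrite divr_gt0.
near=> i => s /andP[s0 sSi].
have sigma0i : 0 <= sigma i by near: i.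
have [SiSi SiT] : Si i <= S /\ Si i + sigma i <= T (k i) by near: i.
have tint : 0 <= eps (k i) * (s + sigma i) <= t0.
  rewrite mulr_ge0 ?addr_ge0//=; last exact: ltW.
  by rewrite mulrC -ler_pdivlMr// (le_trans _ SiT)// lerD2r.
have xki : `|xk (k i) (eps (k i) * (s + sigma i)) - xlim (eps (k i) * (s + sigma i))| < e / 2.
  by move: tint; move: (eps _ * _); near: i.
have tsclose : `|ts - eps (k i) * (s + sigma i)| < del.
  rewrite mulrDr opprD addrCA addrC (le_lt_trans (ler_normD _ _))//.
  rewrite (splitr del) ltrD//; first by near: i.
  rewrite normrN ger0_norm; last by rewrite mulr_ge0// ltW.
  have : eps (k i) < del / 2 / (`|S| + 1) by near: i.
  rewrite ltr_pdivlMr//; apply: le_lt_trans; rewrite ler_wpM2l//; first exact: ltW.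
  have := ler_norm S; lra.
have := Hdel (eps (k i) * (s + sigma i)).
rewrite -ball_normE/= in_itv/= => /(_ tsclose tint); rewrite distrC => xi.
rewrite -(subrKA (xlim (eps (k i) * (s + sigma i)))) (le_lt_trans (ler_normD _ _))//.
by rewrite (splitr e) ltrD.
Unshelve. all: by end_near. Qed.

Lemma fast_ode_on k sigma S : 0 <= sigma -> S + sigma <= T k ->
  ode_on S (fun s => g (xk k (eps k * (s + sigma)), yk k (eps k * (s + sigma)), s + sigma))
    (fun s => yk k (eps k * (s + sigma))).
Proof.
move=> sigma0 ST; have [_ cy _ _ sol_k] := xyk_solution k.
apply: (ode_on_affine cy) => s /andP[s0 sS].
  rewrite /= in_itv/= mulr_ge0 ?addr_ge0//=; last exact: ltW.
  by rewrite mulrC -ler_pdivlMr// (le_trans _ ST)// lerD2r.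
have [|_ dy _ ->] := sol_k (eps k * (s + sigma)).
  rewrite mulr_gt0 ?ltr_wpDr//= mulrC -ltr_pdivlMr//.
  by rewrite (lt_le_trans _ ST)// ltrD2r.
by rewrite [_ / eps k]mulrAC divff ?mul1r// gt_eqF.
Qed.

(** Either the times tend to infinity and the limit lies in [omega_limit g], or they converge to
    some [s >= 0] and the limit is [translate g s]. Forward existence is assumed in both cases. *)
Lemma ultra_cvg_forward {I : Type} (F : set_system I) (tau : I -> R) :
  UltraFilter F -> (forall i, 0 <= tau i) -> exists h,
    [/\ hull g h, forall x y, forward_defined h x y &
        (fun i => translate g (tau i)) @ F --> h].
Proof.
move=> FU tau0; have [h hh gh] := ultra_cvg_translate g_adm tau FU.
exists h; split=> //; apply: g_forward.
have [tauy|[s s0 taus]] := ultra_cvg_real FU tau0.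
  by right; exact: (omega_limit_cvg g_adm d_metrizes _ hh gh tauy).
by left; exists s => //; rewrite (cvg_translate_translate g_adm _ hh.1 gh taus).
Qed.

Lemma xlim_compact : compact (xlim @` `[0, t0]).
Proof. exact: continuous_compact xlim_continuous (@segment_compact _ 0 t0). Qed.

(* Over a window of bounded length the slow variable is asymptotically frozen, so
   the fast variable follows a solution of a frozen equation, which ultimate
   boundedness brings back into the ball it started from. *)
Lemma fast_window : exists rho L M : R, exists N : nat,
  [/\ `|y0| <= rho, 0 < L & forall k sigma, (N <= k)%N -> 0 <= sigma <= T k ->
     `|yk k (eps k * sigma)| <= rho ->
     (forall s, 0 <= s <= L -> s + sigma <= T k -> `|yk k (eps k * (s + sigma))| <= M) /\
     (L + sigma <= T k -> `|yk k (eps k * (L + sigma))| <= rho)].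
Proof.
have [c c0 Hc] := g_bounded xlim_compact.
(* The ball contains the initial value, and its margin of 1 over the ultimate bound [c] absorbs two
   errors of one half. *)
pose rho := Num.max `|y0| (c + 1).
have rho0 : 0 < rho by rewrite lt_max addr_gt0 ?orbT.
have [L' L'0 HL] := Hc (m.+1%:R * rho) (mulr_gt0 (ltr0Sn R m) rho0).
pose L := L' + 1.
have L0 : 0 < L by rewrite ltr_wpDl.
(* By contradiction, with [M] and [N] both equal to [j]: every [j] gives a bad window [p j],
   starting in the ball of radius [rho]. *)
exists rho, L; apply: contrapT => /forallNP noM.
have bad (j : nat) : exists p : nat * R, [/\ (j <= p.1)%N, 0 <= p.2 <= T p.1,
    `|yk p.1 (eps p.1 * p.2)| <= rho &
    ~ ((forall s, 0 <= s <= L -> s + p.2 <= T p.1 ->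
         `|yk p.1 (eps p.1 * (s + p.2))| <= j%:R) /\
       (L + p.2 <= T p.1 -> `|yk p.1 (eps p.1 * (L + p.2))| <= rho))].
  apply: contrapT => /forallNP nop; apply: (noM j%:R).
  exists j; split => //; first by rewrite le_max lexx.
  move=> k sigma jk sigmaT yrho; apply: contrapT => nP.
  by apply: (nop (k, sigma)).
have [p Hp] := choice bad.
pose k j := (p j).1; pose sigma j := (p j).2.
have sigma0 j : 0 <= sigma j by have [_ /andP[]] := Hp j.
have [F [FU ooF]] := ultraFilterLemma (@eventually_filter : ProperFilter \oo).
have [h [hh h_fwd gh]] := ultra_cvg_forward FU sigma0.
have kF : k @ F --> \oo.
  apply: (@cvg_trans _ (k @ \oo)); first by move=> U; exact: ooF.
  move=> U [j _ jU]; exists j => // i /= ji; apply: jU => /=.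
  by apply: (leq_trans ji); have [] := Hp i.
have [ts ts_in eps_ts] : exists2 ts : R, `[0, t0]%classic ts & eps (k j) * sigma j @[j --> F] --> ts.
  apply: ultra_compact_cvg (@segment_compact _ 0 t0) _; apply: nearW => j.
  have [_ /andP[s0 sT] _ _] := Hp j.
  rewrite /= in_itv/= mulr_ge0//=; last exact: ltW.
  by rewrite mulrC -ler_pdivlMr.
have [ys ys_rho Y_ys] : exists2 ys : 'rV[R]_m, `|ys| <= rho &
    yk (k j) (eps (k j) * sigma j) @[j --> F] --> ys.
  apply: ultra_compact_cvg (@compact_norm_le R m rho) _; apply: nearW => j.
  by have [] := Hp j.
pose x := xlim ts.
have [y [ys0 y_sol]] := h_fwd x ys.
have y_ode : ode_on L (fun s => h (x, y s, s)) y.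
  have := forward_solution_ode_on L (conj ys0 y_sol).
  by under eq_fun do rewrite addr0; under [X in ode_on _ _ X]eq_fun do rewrite addr0.
(* The window is truncated at [T (k j)], where [yk (k j)] ceases to solve the equation. *)
pose S j := Num.min L (T (k j) - sigma j).
have SL j : S j <= L by rewrite ge_min lexx.
have ST j : S j + sigma j <= T (k j) by rewrite -lerBrDr ge_min lexx orbT.
have Yy : forall e, 0 < e -> \forall j \near F, forall s, 0 <= s <= S j ->
    `|yk (k j) (eps (k j) * (s + sigma j)) - y s| <= e.
  apply: (continuous_dependence g_adm g_lip
    (X := fun j s => xk (k j) (eps (k j) * (s + sigma j)))
    (Y := fun j s => yk (k j) (eps (k j) * (s + sigma j))) _ hh.1 gh _ _ _ _ y_ode).
  - by apply: nearW.
  - by apply: nearW => j; exact: fast_ode_on.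
  - move=> e e0; apply: (slow_cvg _ kF) eps_ts _ e0.
    + by move: ts_in; rewrite /= in_itv.
    + exact: nearW.
    + by apply: nearW => j; split.
  - by rewrite ys0; under eq_cvg do rewrite add0r.
(* Ultimate boundedness concerns [g], not its limit [h]. Hence [y] is compared with the solution
   [z j] of the equation of [g] frozen at [x], started from [ys] at time [sigma j]. *)
have y_c : `|y L| <= c + 2^-1.
  pose z j := sol g x (sigma j) ys.
  have z_sol j : forward_solution g x (sigma j) ys (z j).
    apply: sol_solution.
    apply: forward_solution_translate; apply: g_forward.
    by left; exists (sigma j) => //=.
  have zy : forall e, 0 < e -> \forall j \near F, forall s, 0 <= s <= L ->
      `|z j (s + sigma j) - y s| <= e.
    apply: (continuous_dependence g_adm g_lip (X := fun _ _ => x) (Si := fun=> L)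
      (Y := fun j s => z j (s + sigma j)) _ hh.1 gh _ _ _ _ y_ode).
    - by apply: nearW.
    - by apply: nearW => j; exact: forward_solution_ode_on (z_sol j).
    - by move=> e e0; apply: nearW => j s _; rewrite subrr normr0.
    - rewrite ys0; under eq_cvg do rewrite add0r (z_sol _).1.
      exact: cvg_cst.
  have /zy : 0 < 2^-1 :> R by rewrite invr_gt0.
  move=> /(@filter_ex _ F)[j /(_ L)]; rewrite lexx ltW// => /(_ isT) zyL.
  have : `|z j (L + sigma j)| <= c.
    apply: (le_trans (norm_le_eucl _)); apply: HL => //.
    - by exists ts.
    - by rewrite lerDl.
    - by apply: (le_trans (eucl_le_norm _)); rewrite ler_wpM2l.
  rewrite distrC in zyL; rewrite -(subrK (z j (L + sigma j)) (y L)) => zc.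
  by apply: (le_trans (ler_normD _ _)); move: zyL zc; rewrite addrC; lra.
have [B yB] := norm_bounded_itv y_ode.1.
have /Yy Yhalf : 0 < 2^-1 :> R by rewrite invr_gt0.
have jB : \forall j \near F, B + 1 <= j%:R.
  by apply: ooF; exact: nbhs_infty_ger.
(* For an index [j] above [B + 1] that follows [y] within one half, both conclusions hold, against
   the choice of [p j]. *)
have [j [/= {}Yhalf {}jB]] := @filter_ex _ F _ _ (filterI Yhalf jB).
have [_ _ _] := Hp j; apply; split.
- move=> s /andP[s0 sL] sT.
  have sS : 0 <= s <= S j by rewrite s0 le_min sL lerBrDr.
  have sL' : 0 <= s <= L by rewrite s0.
  have := Yhalf s sS; have := yB s sL'.
  rewrite -[yk _ _](subrK (y s)) => y1 y2; apply: (le_trans (ler_normD _ _)).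
  by move: y1 y2 jB; rewrite subrK; lra.
- move=> LT.
  have LS : 0 <= L <= S j by rewrite ltW//= le_min lexx lerBrDr.
  have := Yhalf L LS.
  rewrite -[yk _ _](subrK (y L)) => y2; apply: (le_trans (ler_normD _ _)).
  rewrite le_max; apply/orP; right.
  by move: y2 y_c; rewrite subrK; lra.
Qed.

(** Windows of length [L] are chained from time 0: each starts in the ball of radius [rho] and hands
    over to the next in the same ball. Every [sigma] lies in one of them, where [M] is a bound. *)
Lemma fast_bounded : exists M : R, \forall k \near \oo,
  forall sigma, 0 <= sigma <= T k -> `|yk k (eps k * sigma)| <= M.
Proof.
have [rho [L [M [N [y0rho L0 H]]]]] := fast_window.
exists M; exists N => // k /= Nk sigma /andP[sigma0 sigmaT].
have start (j : nat) : j%:R * L <= T k -> `|yk k (eps k * (j%:R * L))| <= rho.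
  elim: j => [_|j IH].
    by rewrite mul0r mulr0; have [_ _ _ ->] := xyk_solution k.
  rewrite -addn1 natrD mulrDl mul1r addrC => jT.
  have jT' : j%:R * L <= T k by apply: le_trans jT; rewrite lerDr ltW.
  have jT0 : 0 <= j%:R * L <= T k by rewrite jT' mulr_ge0// ltW.
  by have [_] := H k _ Nk jT0 (IH jT'); apply.
have := truncn_itv (divr_ge0 sigma0 (ltW L0)); set j := Num.truncn _.
rewrite ler_pdivlMr// ltr_pdivrMr// -addn1 natrD mulrDl mul1r => /andP[jsigma sigmaj].
have jT : 0 <= j%:R * L <= T k by rewrite mulr_ge0//= ?(le_trans jsigma)// ltW.
have [/(_ (sigma - j%:R * L)) + _] := H k _ Nk jT (start j (le_trans jsigma sigmaT)).
by rewrite subrK; apply => //; rewrite subr_ge0 jsigma/= lerBlDr addrC ltW.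
Qed.

(** * Limit points of the fast variable and the attractor *)

Context (r : R) (A : set (rhs R n m * 'rV[R]_n * 'rV[R]_m)).
Hypothesis r_gt0 : 0 < r.
Hypothesis A_attractor : global_attractor d g (tube t0 r xlim) A.

Lemma tube_xlim : tube t0 r xlim (xlim t0).
Proof.
exists t0; first by rewrite /= in_itv/= lexx ltW.
by exists 0; rewrite /= ?addr0// eucl_norm0 ltW.
Qed.

(** Points of [A] chosen with error [1 / (j + 1)] converge along an ultrafilter by compactness, and
    their limit attains the bound. With [delta = 0] this places a point in [A]; with the value of
    [delta_inf] it shows that the infimum is attained. *)
Lemma attractor_near_point p (delta : R) : hull g p.1.1 ->
  (forall e, 0 < e -> exists2 a, A a &
    [/\ d a.1.1 p.1.1 <= delta + e, eucl_norm (a.1.2 - p.1.2) <= delta + e &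
        eucl_norm (p.2 - a.2) <= delta + e]) ->
  exists2 a, A a & [/\ d a.1.1 p.1.1 <= delta, eucl_norm (a.1.2 - p.1.2) <= delta &
    eucl_norm (p.2 - a.2) <= delta].
Proof.
move=> hp H; have [A_omega _ A_compact _ _] := A_attractor.
have A_hull q : A q -> hull g q.1.1 by move=> /A_omega[[[]]].
have seq_ex (j : nat) : exists a, A a /\
    [/\ d a.1.1 p.1.1 <= delta + j.+1%:R^-1,
        eucl_norm (a.1.2 - p.1.2) <= delta + j.+1%:R^-1 &
        eucl_norm (p.2 - a.2) <= delta + j.+1%:R^-1].
  by have [|a Aa Ha] := H j.+1%:R^-1; [rewrite invr_gt0|exists a].
have [a Ha] := choice seq_ex.
have [F [FU ooF]] := ultraFilterLemma (@eventually_filter : ProperFilter \oo).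
have [|b Ab ab] := ultra_compact_cvg (u := a) FU A_compact.
  by apply: nearW => j; have [] := Ha j.
have limit (u : nat -> R) (l : R) : u @ F --> l ->
    (forall j, u j <= delta + j.+1%:R^-1) -> l <= delta.
  move=> ul udelta; apply/ler_addgt0Pr => e e0.
  have e2 : 0 < e / 2 by rewrite divr_gt0.
  move/cvgrPdist_lt : ul => /(_ _ e2) ul.
  have small : \forall j \near F, j.+1%:R^-1 < e / 2.
    by apply: ooF; exact: (near_infty_natSinv_lt (PosNum e2)).
  have [j [/= /ltr_normlW lu je]] := @filter_ex _ F _ _ (filterI ul small).
  by move: je lu (udelta j); set v := (_.+1%:R)^-1; lra.
have a11 : (fun j => (a j).1.1) @ F --> b.1.1.
  exact: (cvg_comp _ _ ab (cvg_comp _ _ cvg_fst cvg_fst)).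
have a12 : (fun j => (a j).1.2) @ F --> b.1.2.
  exact: (cvg_comp _ _ ab (cvg_comp _ _ cvg_fst cvg_snd)).
have a2 : (fun j => (a j).2) @ F --> b.2.
  exact: (cvg_comp _ _ ab cvg_snd).
exists b => //; split.
(* Convergence in the compact-open topology becomes closeness in [d] on the hull, and the triangle
   inequality concludes. *)
- apply/ler_addgt0Pr => e e0; have e2 : 0 < e / 2 by rewrite divr_gt0.
  have aj_hull j : hull g (a j).1.1 by apply: A_hull; have [] := Ha j.
  have FF : Filter F by typeclasses eauto.
  have close := (metrizes_cvgP d_metrizes FF (A_hull _ Ab) aj_hull).1 a11 _ e2.
  have small : \forall j \near F, j.+1%:R^-1 < e / 2.
    by apply: ooF; exact: (near_infty_natSinv_lt (PosNum e2)).
  have [j [/= bj je]] := @filter_ex _ F _ _ (filterI close small).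
  have [_ _ _ /(_ b.1.1 (a j).1.1 p.1.1)] := d_metric.
  move=> /(_ (A_hull _ Ab) (aj_hull j) hp).
  by have [_ [+ _ _]] := Ha j; move: je bj; set v := (_.+1%:R)^-1; lra.
- apply: (limit (fun j => eucl_norm ((a j).1.2 - p.1.2))).
    by apply: continuous_cvg; [exact: continuous_eucl_norm|apply: cvgB => //; exact: cvg_cst].
  by move=> j; have [_ []] := Ha j.
- apply: (limit (fun j => eucl_norm (p.2 - (a j).2))).
    by apply: continuous_cvg; [exact: continuous_eucl_norm|apply: cvgB => //; exact: cvg_cst].
  by move=> j; have [_ []] := Ha j.
Qed.

Lemma ultra_limit_attractor (F : set_system nat) : UltraFilter F -> \oo `<=` F ->
  exists h0 ys, [/\ omega_limit g h0, (fun k => translate g (T k)) @ F --> h0,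
    yk k (eps k * T k) @[k --> F] --> ys & A (h0, xlim t0, ys)].
Proof.
move=> FU ooF.
have [A_omega _ _ _ A_attracts] := A_attractor.
have [M HM] := fast_bounded.
have TF : T @ F --> +oo by move=> U /T_cvgy; exact: ooF.
have M0 : 0 <= M.
  have [k /(_ 0)] := @filter_ex _ F _ _ (ooF _ HM).
  by rewrite lexx divr_ge0 ?(ltW t0_gt0) ?(ltW (eps_gt0 k))// => /(_ isT); exact: le_trans.
(* The same bound [M] serves for every [s], so the set [D] below does not depend on the length of
   the window. *)
have Mk s : 0 <= s -> \forall k \near F, 0 <= T k - s /\ `|yk k (eps k * (T k - s))| <= M.
  move=> s0; have /cvgryPge/(_ s) sT := TF; near=> k.
  have sTk : s <= T k by near: k.
  split; first by rewrite subr_ge0.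
  have : forall sigma, 0 <= sigma <= T k -> `|yk k (eps k * sigma)| <= M.
    by near: k; exact: ooF.
  by apply; rewrite subr_ge0 sTk/= gerBl.
have [h0 hh0 gh0] := ultra_cvg_translate g_adm T FU.
have h0_omega : omega_limit g h0.
  exact: (omega_limit_cvg g_adm d_metrizes _ hh0 gh0 TF).
have [ys _ Yys] : exists2 ys : 'rV[R]_m, `|ys| <= M & yk k (eps k * T k) @[k --> F] --> ys.
  apply: ultra_compact_cvg (@compact_norm_le R m M) _.
  by apply: filterS (Mk 0 (lexx 0)) => k /=; rewrite subr0 => -[].
exists h0, ys; split=> //.
pose p := (h0, xlim t0, ys).
pose D : set 'rV[R]_m := [set y | `|y| <= M].
have p_flow s : 0 < s -> (semiflow s @` (omega_limit g `*` tube t0 r xlim `*` D)) p.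
  move=> s0.
  have [h hh gh] := ultra_cvg_translate g_adm (fun k => T k - s) FU.
  have TsF : (fun k => T k - s) @ F --> +oo.
    apply/cvgryPge => B; have /cvgryPge/(_ (B + s)) := TF.
    by apply: (@filterS _ F) => k /=; rewrite lerBrDr.
  have h_omega : omega_limit g h.
    exact: (omega_limit_cvg g_adm d_metrizes _ hh gh TsF).
  have [y yM Yy] : exists2 y : 'rV[R]_m, `|y| <= M &
      yk k (eps k * (T k - s)) @[k --> F] --> y.
    apply: ultra_compact_cvg (@compact_norm_le R m M) _.
    by apply: filterS (Mk s (ltW s0)) => k /= [].
  exists (h, xlim t0, y); first by split=> //; split=> //=; exact: tube_xlim.
  (* Both sides are pointwise limits of the same values of [g], at time [q.2 + T k]. *)
  have hs_h0 : translate h s = h0.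
    apply/funext => q.
    have h1 := cvg_translate_pointwise (p := (q.1, q.2 + s)) _ hh.1 gh.
    have h2 := cvg_translate_pointwise (p := q) _ hh0.1 gh0.
    have shift : (fun k => g (q.1, q.2 + s + (T k - s))) = (fun k => g (q.1, q.2 + T k)).
      by apply/funext => k; congr (g (_, _)); ring.
    rewrite /= shift in h1; exact: (cvg_unique (@norm_hausdorff _ _) (h1 _) (h2 _)).
  rewrite /semiflow/= hs_h0; congr (_, _).
  have z_sol : forward_solution h (xlim t0) 0 y (sol h (xlim t0) 0 y).
    apply: sol_solution; apply: g_forward; by right.
  have z_ode : ode_on s (fun u => h (xlim t0, sol h (xlim t0) 0 y u, u)) (sol h (xlim t0) 0 y).
    have := forward_solution_ode_on s z_sol.
    by under eq_fun do rewrite addr0; under [X in ode_on _ _ X]eq_fun do rewrite addr0.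
  have Tk0 : \forall k \near F, 0 <= T k - s by apply: filterS (Mk s (ltW s0)) => k [].
  have Yz : forall e, 0 < e -> \forall k \near F, forall u, 0 <= u <= s ->
      `|yk k (eps k * (u + (T k - s))) - sol h (xlim t0) 0 y u| <= e.
    apply: (continuous_dependence g_adm g_lip (Si := fun=> s)
      (X := fun k u => xk k (eps k * (u + (T k - s))))
      (Y := fun k u => yk k (eps k * (u + (T k - s)))) _ hh.1 gh _ _ _ _ z_ode).
    - by apply: nearW.
    - by apply: filterS Tk0 => k Tk0; apply: fast_ode_on => //; rewrite subrKC.
    - move=> e e0; apply: (slow_cvg (k := id) (S := s) _ _ _ Tk0) _ _ e0.
      + by move=> U; exact: ooF.
      + by rewrite ltW ?lexx.
      + by apply: nearW => k; rewrite subrKC.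
      + have -> : (fun k => eps k * (T k - s)) = (fun k => t0 - eps k * s).
          by apply/funext => k; rewrite mulrBr mulrC divfK// gt_eqF.
        rewrite -[X in _ --> X]subr0 -[X in _ - X](mul0r s).
        apply: cvgB; first exact: cvg_cst.
        by apply: cvgM; [move=> U /eps_cvg0; exact: ooF|exact: cvg_cst].
    - by rewrite z_sol.1; under eq_cvg do rewrite add0r.
  apply: (cvg_unique (@norm_hausdorff _ _) _ Yys).
  apply/cvgrPdist_le => e /Yz; apply: (@filterS _ F) => k /(_ s).
  by rewrite lexx ltW// subrKC distrC => /(_ isT).
(* A point of [A] at distance 0 from [p] in each of the three components is [p] itself. *)
suff [[[h x] y] Ap [/= hp xp yp]] : exists2 a, A a &
    [/\ d a.1.1 p.1.1 <= 0, eucl_norm (a.1.2 - p.1.2) <= 0 & eucl_norm (p.2 - a.2) <= 0].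
  have hh : hull g h by have [[[]]] := A_omega _ Ap.
  have -> : h0 = h.
    apply/esym/(hull_dist0 d_metric hh hh0)/eqP; rewrite eq_le hp.
    by have [/(_ h h0 hh hh0)] := d_metric.
  have -> : xlim t0 = x.
    by apply/esym/eqP; rewrite -subr_eq0 -normr_le0 (le_trans (norm_le_eucl _)).
  suff -> : ys = y by [].
  by apply/eqP; rewrite -subr_eq0 -normr_le0 (le_trans (norm_le_eucl _)).
apply: attractor_near_point => // e e0.
have D0 : D !=set0 by exists 0; rewrite /D/= normr0.
have D_bounded : bounded_set D.
  by exists M; split=> [|M' MM' y /= yM]; rewrite ?num_real// (le_trans yM)// ltW.
have nbhs0e : nbhs (0%E : \bar R) [set z | (z < e%:E)%E].
  by apply: open_nbhs_nbhs; split; [exact: open_ereal_lt_ereal|rewrite /= lte_fin].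
have near_e : \forall s \near +oo, (hsdist (prod_dist d)
    (semiflow s @` (omega_limit g `*` tube t0 r xlim `*` D)) A < e%:E)%E.
  exact: (A_attracts D D_bounded D0 _ nbhs0e).
(* One positive time [s] at which the image of [D] is [e]-close to [A] suffices, since [p] lies in
   all these images. *)
have [s [/= se s0]] := @filter_ex _ (pinfty_nbhs R) _ _
  (filterI near_e (nbhs_pinfty_gt (num_real 0))).
have : (ereal_inf [set (prod_dist d p a)%:E | a in A] < e%:E)%E.
  apply: le_lt_trans se; apply: ereal_sup_ubound.
  by exists p => //; exact: p_flow.
move=> /ereal_inf_lt[_ [a Aa <-]]; rewrite lte_fin /prod_dist !gt_max => /and3P[hd xd yd].
exists a => //; rewrite !add0r; split.
- have a_hull : hull g a.1.1 by have [[[]]] := A_omega _ Aa.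
  by have [_ _ sym _] := d_metric; rewrite (sym _ _ a_hull hh0) ltW.
- by rewrite eucl_normB ltW.
- exact: ltW.
Unshelve. all: by end_near. Qed.

End fast_slow_limit.

(** * Extended-real distances to sets, and the three limits *)

Section extended_distance.
Context {R : realType}.

(** The bound with [e = 1] makes the terms eventually finite, which reduces the claim to real
    sequences. *)
Lemma cvge0_le (u : nat -> \bar R) : (forall k, (0 <= u k)%E) ->
  (forall e : R, 0 < e -> \forall k \near \oo, (u k <= e%:E)%E) -> u @ \oo --> 0%E.
Proof.
move=> u0 ue; apply/fine_cvgP.
have fin k (e : R) : (u k <= e%:E)%E -> u k \is a fin_num.
  by move=> uke; rewrite ge0_fin_numE// (le_lt_trans uke)// ltry.
split; first by apply: filterS (ue 1 ltr01) => k; exact: fin.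
apply/cvgr0Pnorm_le => e e0; apply: filterS (ue e e0) => k uk /=.
by rewrite ger0_norm ?fine_ge0// -lee_fin fineK// (fin k e).
Qed.

Context {T : Type} (d : T -> T -> R).

Lemma hsdist1 p (B : set T) : hsdist d [set p] B = ereal_inf [set (d p y)%:E | y in B].
Proof. by rewrite /hsdist image_set1 ereal_sup1. Qed.

Lemma hsdist1_le p (B : set T) y e : B y -> d p y <= e -> (hsdist d [set p] B <= e%:E)%E.
Proof.
move=> By dpy; rewrite hsdist1; apply: ge_ereal_inf.
by exists (d p y)%:E; [exists y|rewrite lee_fin].
Qed.

Lemma hsdist1_lt p (B : set T) e : (hsdist d [set p] B < e%:E)%E -> exists2 y, B y & d p y < e.
Proof.
by rewrite hsdist1 => /ereal_inf_lt[_ [y By <-]]; rewrite lte_fin; exists y.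
Qed.

Lemma hsdist1_ge0 p (B : set T) : (forall y, 0 <= d p y) -> (0 <= hsdist d [set p] B)%E.
Proof.
by move=> d0; rewrite hsdist1; apply: le_ereal_inf_tmp => _ [y _ <-]; rewrite lee_fin.
Qed.

End extended_distance.

Theorem theorem5p11 (R : realType) (n m : nat)
  (f : 'rV[R]_n * 'rV[R]_m -> 'rV[R]_n) (g : rhs R n m)
  (d : rhs R n m -> rhs R n m -> R)
  (x0 : 'rV[R]_n) (y0 : 'rV[R]_m) (t0 : R)
  (eps : nat -> R) (xk : nat -> R -> 'rV[R]_n) (yk : nat -> R -> 'rV[R]_m)
  (xlim : R -> 'rV[R]_n) (r : R) (A : set (rhs R n m * 'rV[R]_n * 'rV[R]_m)) :
  continuous f ->
  (exists a b : R, [/\ 0 < a, 0 < b &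
     forall x y, eucl_norm (f (x, y)) <= a + b * eucl_norm x]) ->
  admissible g ->
  unif_lipschitz g ->
  metric_on (hull g) d ->
  metrizes (hull g) d ->
  (forall h, ([set translate g tau0 | tau0 in [set s | 0 <= s]] `|` omega_limit g) h ->
     forall x y, forward_defined h x y) ->
  (forall K : set 'rV[R]_n, compact K -> unif_ultimately_bounded g K) ->
  0 < t0 ->
  (forall k, 0 < eps k) ->
  nonincreasing_seq eps ->
  eps @ \oo --> 0 ->
  (forall k, fast_slow_solution f g x0 y0 t0 (eps k) (xk k) (yk k)) ->
  {uniform `[0, t0], xk @ \oo --> xlim} ->
  0 < r ->
  let K0 := tube t0 r xlim in
  global_attractor d g K0 A ->
  let gk k := translate g (t0 / eps k) in
  let Yk k := fast_time (eps k) (yk k) (t0 / eps k) in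
  let delta k := delta_inf d g K0 A (gk k) (xlim t0) (Yk k) in
  [/\ delta k @[k --> \oo] --> 0%E,
      hsdist eucl_dist [set Yk k]
        (inflated_section d g K0 A (gk k) (xlim t0) (delta k))
        @[k --> \oo] --> 0%E
    & forall h0, hull g h0 -> d (gk k) h0 @[k --> \oo] --> 0 ->
        omega_limit g h0 /\
        hsdist eucl_dist [set Yk k] (attractor_section A h0 (xlim t0)) @[k --> \oo] --> 0%E].
Proof.
move=> _ _ g_adm g_lip d_metric d_metrizes g_fwd g_bdd t0_gt0 eps_gt0 _ eps0 sol_k xk_cvg r0.
move=> K0 A_attr gk Yk delta.
have [A_omega _ _ _ _] := A_attr.
have [_ _ d_sym d_triangle] := d_metric.
have gk_hull k : hull g (gk k) by exact: hull_translate.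
have A_hull q : A q -> hull g q.1.1 by move=> /A_omega[[[]]].
have ultra_limit (F : set_system nat) : UltraFilter F -> \oo `<=` F ->
    exists h ys, [/\ hull g h, forall e, 0 < e -> \forall k \near F, d h (gk k) < e,
      forall e, 0 < e -> \forall k \near F, eucl_dist (Yk k) ys <= e & A (h, xlim t0, ys)].
  move=> FU ooF.
  have [h [ys [[hh _] gh Yys Ah]]] := ultra_limit_attractor g_adm g_lip d_metric d_metrizes
    g_fwd g_bdd t0_gt0 eps_gt0 eps0 sol_k xk_cvg r0 A_attr FU ooF.
  exists h, ys; split=> //; first exact: ((metrizes_cvgP d_metrizes _ hh gk_hull).1 gh).
  move=> e e0; have e1 : 0 < e / m.+1%:R by rewrite divr_gt0.
  move/cvgrPdist_le : Yys => /(_ _ e1); apply: (@filterS _ F) => k /=.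
  rewrite distrC ler_pdivlMr// mulrC; apply: le_trans; exact: eucl_le_norm.
have delta_ge0 k : (0 <= delta k)%E.
  by apply: le_ereal_inf_tmp => _ [e [e0 _ _] <-]; rewrite lee_fin ltW.
(* Near the limit, [e] itself belongs to the set defining [delta k]: [h] is the nearby omega-limit
   point and [ys] the nearby point of the inflated section. *)
have delta_le e : 0 < e -> \forall k \near \oo, (delta k <= e%:E)%E.
  move=> e0; apply: near_ultra => F FU ooF.
  have [h [ys [hh /(_ _ e0) dh /(_ _ e0) Yys Ah]]] := ultra_limit F FU ooF.
  have [[[_ h_omega] K0x] _] := A_omega _ Ah.
  apply: filterS2 dh Yys => k dhk Yysk.
  apply: ereal_inf_lbound; exists e => //; split=> //.
    by apply: (hsdist1_le (y := h)); [|rewrite d_sym// ltW].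
  apply: hsdist1_le Yysk; exists (h, xlim t0) => //=; split=> //.
    by rewrite lee_fin ltW.
  by rewrite subrr eucl_norm0 lee_fin ltW.
(* An infimum need not satisfy the conditions that define it. Here it does: radii [e'] below
   [delta k + e / 2], with a further [e / 2] to pick a point in the section, feed the compactness
   argument. *)
have hsdist_delta k : delta k \is a fin_num ->
    (hsdist eucl_dist [set Yk k] (inflated_section d g K0 A (gk k) (xlim t0) (delta k))
      <= delta k)%E.
  move=> delta_fin; rewrite -[leRHS](fineK delta_fin).
  have [|a Aa [da xa ya]] := attractor_near_point d_metric d_metrizes A_attr
     (p := (gk k, xlim t0, Yk k)) (delta := fine (delta k)) (gk_hull k).
    move=> e e0; have e2 : 0 < e / 2 by rewrite divr_gt0.
    have : (delta k < (fine (delta k) + e / 2)%:E)%E.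
      by rewrite -[X in (X < _)%E](fineK delta_fin) lte_fin ltrDl.
    move=> /ereal_inf_lt[_ [e' [e'0 _ hY] <-]]; rewrite lte_fin => e'_lt.
    have hY_lt : (hsdist eucl_dist [set Yk k]
        (inflated_section d g K0 A (gk k) (xlim t0) e'%:E) < (e' + e / 2)%:E)%E.
      by apply: (le_lt_trans hY); rewrite lte_fin ltrDl.
    have [y [q /= [q_omega qK]]] := hsdist1_lt hY_lt.
    rewrite !lee_fin => dq xq Aq dy.
    by exists (q.1, q.2, y) => //=; split; [lra|lra|apply: ltW; move: dy; rewrite /eucl_dist; lra].
  apply: (hsdist1_le (y := a.2)); last exact: ya.
  exists a.1; last by rewrite /attractor_section/=; case: a Aa {da xa ya} => -[].
  have [[a_omega aK0] _] := A_omega _ Aa.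
  by split=> //; rewrite -(fineK delta_fin) lee_fin.
split.
- exact: cvge0_le delta_le.
- apply: cvge0_le => [k|e e0]; first by apply: hsdist1_ge0 => y; exact: eucl_norm_ge0.
  apply: filterS (delta_le e e0) => k delta_e; apply: (le_trans _ delta_e); apply: hsdist_delta.
  by rewrite ge0_fin_numE// (le_lt_trans delta_e)// ltry.
- move=> h0 hh0 /cvgr0Pnorm_lt dh0.
  have {}dh0 e : 0 < e -> \forall k \near \oo, d h0 (gk k) < e.
    by move=> /dh0; apply: filterS => k; rewrite d_sym// => /ltr_normlW.
  split.
    split=> //; exists (fun k => t0 / eps k); split; first exact: T_cvgy.
    exact/(metrizes_cvgP d_metrizes _ hh0 gk_hull).
  apply: cvge0_le => [k|e e0]; first by apply: hsdist1_ge0 => y; exact: eucl_norm_ge0.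
  apply: near_ultra => F FU ooF.
  have [h [ys [hh dh /(_ _ e0) Yys Ah]]] := ultra_limit F FU ooF.
  (* Both are limits of [gk] along [F], so their distance is below every [e']. *)
  have h0h : h0 = h.
    apply: (hull_dist0 d_metric hh0 hh); apply/eqP; rewrite eq_le.
    have [-> // _ _ _] := d_metric; rewrite andbT.
    apply/ler_addgt0Pr => e' e'0; rewrite add0r.
    have e2 : 0 < e' / 2 by rewrite divr_gt0.
    have [k [/= h0k hk]] := @filter_ex _ F _ _ (filterI (ooF _ (dh0 _ e2)) (dh _ e2)).
    by have := d_triangle h0 (gk k) h hh0 (gk_hull k) hh; rewrite (d_sym (gk k))//; lra.
  apply: (@filterS _ F _ _ _ _ Yys) => k {}Yys.
  by apply: hsdist1_le Yys; rewrite /attractor_section/= h0h.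
Qed.
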